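(* Fix an integer $k\ge0$, a mesh of size $h$, a time step $\Delta t>0$, one of the numerical flux pairs (left-right alternating, right-left alternating, or central), and a constant $c_0\in(0,1)$. Let $(\rho_\varepsilon|_{t=0},g_\varepsilon|_{t=0})$, $\varepsilon\in(0,\varepsilon_0]$, be a family of initial data with $\langle g_\varepsilon|_{t=0}\rangle=0$ satisfying: ($\mathcal A1$) at $t=0$, $\rho_\varepsilon\rightharpoonup\rho_0$ and $\langle vg_\varepsilon\rangle\rightharpoonup\langle vg_0\rangle$ weakly in $L^2(\Omega_x)$ as $\varepsilon\to0$; ($\mathcal A2$) $\sup_\varepsilon\|\rho_\varepsilon\|\,|_{t=0}<\infty$ and $\sup_\varepsilon|||g_\varepsilon|||\,|_{t=0}<\infty$. Let $(\rho^n_{\varepsilon,\Delta t,h},g^n_{\varepsilon,\Delta t,h})_{n\ge0}$ be the corresponding DG-IMEX1 solutions, initialized by $\rho^0_{\varepsilon,\Delta t,h}=\pi_h\rho_\varepsilon|_{t=0}$, $g^0_{\varepsilon,\Delta t,h}=\pi_hg_\varepsilon|_{t=0}$, and let $q^n_{\varepsilon,\Delta t,h}=\langle vg^n_{\varepsilon,\Delta t,h}\rangle$. Assume $$\Delta t<\Delta t_{stab,c_0}=\frac{h}{\alpha_1+\alpha_2\alpha_3}\Big((1-c_0)h+\min\big(\varepsilon,\tfrac{(1-c_0)\alpha_2h}{\alpha_1}\big)\alpha_3\Big)$$ for all $\varepsilon$ in the family. Then there exist $\rho^n_{\Delta t,h},q^n_{\Delta t,h}\in U_h^k$, $n\ge1$,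 such that for every $n\ge1$, as $\varepsilon\to0$, $$\rho^n_{\varepsilon,\Delta t,h}\to\rho^n_{\Delta t,h},\qquad q^n_{\varepsilon,\Delta t,h}\rightharpoonup q^n_{\Delta t,h}\ \text{ in }L^2(\Omega_x),$$ and, with $\rho^0_{\Delta t,h}=\pi_h\rho_0|_{t=0}$ and $q^0_{\Delta t,h}=\pi_h\langle vg_0\rangle|_{t=0}$, these limits satisfy for all $n\ge0$ $$\Big(\frac{\rho^{n+1}_{\Delta t,h}-\rho^n_{\Delta t,h}}{\Delta t},\phi\Big)-\sum_i\int_{I_i}q^n_{\Delta t,h}\,\partial_x\phi\,dx-\sum_i\widehat{(q^n_{\Delta t,h})}_{i-1/2}[\phi]_{i-1/2}=0\quad\forall\phi\in U_h^k,$$ $$(q^{n+1}_{\Delta t,h},\psi)=\langle v^2\rangle\Big(\sum_i\int_{I_i}\rho^{n+1}_{\Delta t,h}\,\partial_x\psi\,dx+\sum_i\widehat{(\rho^{n+1}_{\Delta t,h})}_{i-1/2}[\psi]_{i-1/2}\Big)\quad\forall\psi\in U_h^k,$$ where $(\widehat q,\widehat\rho)$ is the same flux pair as in the scheme, i.e. $(q^-,\rho^+)$, $(q^+,\rho^-)$ or $(\{q\},\{\rho\})$ respectively.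
   Context: Model. Either (telegraph equation) $\Omega_v=\{-1,1\}$ and $\langle f\rangle=\int_{\Omega_v} f\,d\mu=\frac12(f(v=-1)+f(v=1))$, or (one-group transport equation in slab geometry) $\Omega_v=[-1,1]$ and $\langle f\rangle=\int_{\Omega_v} f\,d\mu=\frac12\int_{-1}^1 f(v)\,dv$. The kinetic equation is $\varepsilon f_t+v\partial_x f=\frac1\varepsilon(\langle f\rangle-f)$ for $f=f(x,v,t)$, $x\in\Omega_x=[x_{\min},x_{\max}]$, $v\in\Omega_v$, $t>0$, with periodic boundary conditions in $x$. Writing $f=\rho+\varepsilon g$ with $\rho=\langle f\rangle$, $\langle g\rangle=0$, and $\Pi f=\langle f\rangle$, it is equivalent to the micro-macro system $\partial_t\rho+\partial_x\langle vg\rangle=0$, $\partial_t g+\frac1\varepsilon(\mathbf I-\Pi)(v\partial_x g)+\frac1{\varepsilon^2}v\partial_x\rho=-\frac1{\varepsilon^2}g$. Initial data $\rho_\varepsilon|_{t=0}$, $\rho_0|_{t=0}$ lie in $L^2(\Omega_x)$ and $g_\varepsilon|_{t=0}$, $g_0|_{t=0}$ in $L^2(\Omega_x\times\Omega_v;dx\,d\mu)$. ''$\rightharpoonup$'' denotes weak convergence. Discrete space. $\Omega_x$ is divided into $N$ elements $I_i=[x_{i-1/2},x_{i+1/2}]$, $i=1,\dots,N$, of equal length $h$ (with $x_{1/2}$ and $x_{N+1/2}$ identified by periodicity). $U_h^k=\{u\in L^2(\Omega_x): u|_{I_i}\in P^k(I_i)\ \forall i\}$, $P^k$ = polynomials of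 degree at most $k$; since it is finite dimensional, convergence in it can be taken in any norm. For piecewise smooth $u$, $u^\pm_{i-1/2}$ are the right/left limits at $x_{i-1/2}$, $[u]=u^+-u^-$, $\{u\}=\frac12(u^++u^-)$. All sums $\sum_i$ are over $i=1,\dots,N$. $(\cdot,\cdot)$ and $\|\cdot\|$ are the $L^2(\Omega_x)$ inner product and norm, and $|||\phi|||=\langle\|\phi\|^2\rangle^{1/2}$. $\pi_h$ is the $L^2(\Omega_x)$-orthogonal projection onto $U_h^k$ (applied for each $v$). Functions of $(x,v)$ ''in $U_h^k$'' belong to $U_h^k$ in $x$ for each $v$ (and are square integrable in $v$ with respect to $\mu$). Forms. $a_h(g,\phi)=-\sum_i\int_{I_i}\langle vg\rangle\partial_x\phi\,dx-\sum_i\widehat{\langle vg\rangle}_{i-1/2}[\phi]_{i-1/2}$; $d_h(\rho,\psi)=\sum_i\int_{I_i}\rho\,\partial_x\psi\,dx+\sum_i\widehat\rho_{i-1/2}[\psi]_{i-1/2}$; $\mathcal D_h(g;v)\in U_h^k$ is defined by $(\mathcal D_h(g;v),\psi)=-\sum_i\int_{I_i}vg\,\partial_x\psi\,dx-\sum_i\widetilde{(vg)}_{i-1/2}[\psi]_{i-1/2}$ for all $\psi\in U_h^k$, with the upwind flux $\widetilde{vg}=v\{g\}-\frac{|v|}2[g]$ (i.e. $vg^-$ if $v>0$, $vg^+$ if $v<0$); $b_{h,v}(g,\psi)=(\mathcal D_h(g;v)-\langle\mathcal D_h(g;v)\rangle,\psi)$. Flux pairs: left-right alternating $\widehat{\langle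 vg\rangle}=\langle vg\rangle^-,\ \widehat\rho=\rho^+$; right-left alternating $\widehat{\langle vg\rangle}=\langle vg\rangle^+,\ \widehat\rho=\rho^-$; central $\widehat{\langle vg\rangle}=\{\langle vg\rangle\},\ \widehat\rho=\{\rho\}$. DG-IMEX1 scheme (subscripts $\varepsilon,\Delta t,h$ abbreviated to $h$). Given $\rho_h^n(\cdot),g_h^n(\cdot,v)\in U_h^k$, find $\rho_h^{n+1}(\cdot),g_h^{n+1}(\cdot,v)\in U_h^k$ such that for all $\phi,\psi\in U_h^k$ and all $v\in\Omega_v$, $\big(\frac{\rho_h^{n+1}-\rho_h^n}{\Delta t},\phi\big)+a_h(g_h^n,\phi)=0$, $\big(\frac{g_h^{n+1}-g_h^n}{\Delta t},\psi\big)+\frac1\varepsilon b_{h,v}(g_h^n,\psi)-\frac v{\varepsilon^2}d_h(\rho_h^{n+1},\psi)=-\frac1{\varepsilon^2}(g_h^{n+1},\psi)$. Constants. $C_{\rm inv},\hat C_{\rm inv}>0$ are constants (depending only on $k$) such that for all intervals $[a,b]$ and $w\in P^k([a,b])$: $|w(y)|^2(b-a)\le C_{\rm inv}\int_a^b w^2dx$ for $y=a$ or $b$, and $(b-a)^2\int_a^b|w_x|^2dx\le\hat C_{\rm inv}\int_a^b w^2dx$. With $\|v\|_\infty=\sup_{v\in\Omega_v}|v|$: $\alpha_1=(\|v\|_\infty^2+\langle v^2\rangle)\hat C_{\rm inv}$, $\alpha_2=2(\|v\|_\infty+\langle|v|\rangle)C_{\rm inv}$, $\alpha_3=2\|v\|_\infty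 C_{\rm inv}$. *)

(* Defs.v *)
From HB Require Import structures.
From mathcomp Require Import all_boot all_order all_algebra.
From mathcomp Require Import all_classical all_reals all_analysis.

Set Implicit Arguments.
Unset Strict Implicit.
Unset Printing Implicit Defensive.

Import Order.TTheory GRing.Theory Num.Theory.
Import numFieldNormedType.Exports.

Local Open Scope classical_set_scope.
Local Open Scope ring_scope.

Inductive velocity_model := Telegraph | Slab.

Inductive flux_pair := LeftRight | RightLeft | Central.

Definition Omega_v (R : realType) (m : velocity_model) : set R :=
  match m with
  | Telegraph => [set -1; 1]
  | Slab => `[-1, 1]
  end.

Arguments Omega_v R m : clear implicits.

Definition mu_v (R : realType) (m : velocity_model) :
    set (measurableTypeR R) -> \bar R :=
  match m with
  | Telegraph =>
      mscale (2^-1 : R)%:nng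
        (measure_add (dirac (-1 : measurableTypeR R))
                     (dirac (1 : measurableTypeR R)))
  | Slab =>
      mscale (2^-1 : R)%:nng
        (mrestr (@lebesgue_measure R) (measurable_itv `[-1, 1]))
  end.

(* [mu_v] is made a finite measure so that it can be integrated against and
   enter the product measure [\x]. *)
Section mu_v_measure.
Variables (R : realType) (m : velocity_model).

Let mu_v0 : mu_v (R := R) m set0 = 0%E.
Proof. by case: m => /=; rewrite measure0. Qed.

Let mu_v_ge0 A : (0 <= mu_v (R := R) m A)%E.
Proof. by case: m => /=; exact: measure_ge0. Qed.

Let mu_v_sigma_additive : semi_sigma_additive (mu_v (R := R) m).
Proof. by case: m => /=; exact: measure_semi_sigma_additive. Qed.

HB.instance Definition _ := isMeasure.Build _ (measurableTypeR R) R
  (mu_v m) mu_v0 mu_v_ge0 mu_v_sigma_additive.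

Let mu_v_fin : fin_num_fun (mu_v (R := R) m).
Proof.
move=> A mA; case: m => /=; rewrite /mscale fin_numM//.
  rewrite /measure_add /msum; apply/sum_fin_numP => -[[|n] ltn] _ _ /=;
  exact: fin_num_measure.
rewrite ge0_fin_numE ?measure_ge0//.
apply: (@le_lt_trans _ _ (@lebesgue_measure R `[-1, 1])).
  by apply: le_measure => //; rewrite inE; [exact: measurableI | exact: measurable_itv].
by rewrite lebesgue_measure_itv/=; case: ifP; rewrite -?EFinB ltry.
Qed.

HB.instance Definition _ := Measure_isFinite.Build _ (measurableTypeR R) R
  (mu_v m) mu_v_fin.

End mu_v_measure.

Definition avg (R : realType) (m : velocity_model) (f : R -> R) : R :=
  \int[mu_v m]_(v in Omega_v R m) f v.

Definition vsup (R : realType) (m : velocity_model) : R :=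
  sup [set `|v| | v in Omega_v R m].

Record mesh (R : realType) := Mesh {
  xmin : R;
  xmax : R;
  nelt : nat;
  xmin_lt_xmax : xmin < xmax;
  nelt_gt0 : (0 < nelt)%N }.

Definition Omega_x (R : realType) (M : mesh R) : set R := `[xmin M, xmax M].

Definition hx (R : realType) (M : mesh R) : R :=
  (xmax M - xmin M) / (nelt M)%:R.

(* Indices start at 0: [node M j] is $x_{j+1/2}$ and, for [i : 'I_(nelt M)],
   [cell M i] is $I_{i+1}$, with end points [node M i] and [node M i.+1]. *)
Definition node (R : realType) (M : mesh R) (j : nat) : R :=
  xmin M + j%:R * hx M.

Definition cell (R : realType) (M : mesh R) (i : 'I_(nelt M)) : set R :=
  `[node M i, node M i.+1].

Definition cell_int (R : realType) (M : mesh R) (i : 'I_(nelt M)) : set R :=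
  `]node M i, node M i.+1[.

(* Elements of $L^2$ are represented by square-integrable functions. *)
Definition L2x (R : realType) (M : mesh R) (f : R -> R) : Prop :=
  measurable_fun (Omega_x M : set (measurableTypeR R)) f /\
  (@lebesgue_measure R).-integrable (Omega_x M) (fun x => (f x ^+ 2)%:E).

Definition L2v (R : realType) (m : velocity_model) (f : R -> R) : Prop :=
  measurable_fun (Omega_v R m : set (measurableTypeR R)) f /\
  (mu_v m).-integrable (Omega_v R m) (fun v => (f v ^+ 2)%:E).

Definition L2xv (R : realType) (M : mesh R) (m : velocity_model)
    (g : R -> R -> R) : Prop :=
  measurable_fun
    (Omega_x M `*` Omega_v R m
       : set (measurableTypeR R * measurableTypeR R)%type)
    (fun z => g z.1 z.2) /\
  (@lebesgue_measure R \x mu_v m)%E.-integrable (Omega_x M `*` Omega_v R m)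
    (fun z => (g z.1 z.2 ^+ 2)%:E).

Definition ipx (R : realType) (M : mesh R) (f g : R -> R) : R :=
  \int[@lebesgue_measure R]_(x in Omega_x M) (f x * g x).

Definition normx (R : realType) (M : mesh R) (f : R -> R) : R :=
  Num.sqrt (ipx M f f).

Definition normxv (R : realType) (M : mesh R) (m : velocity_model)
    (g : R -> R -> R) : R :=
  Num.sqrt (avg m (fun v => normx M (g^~ v) ^+ 2)).

(* Both convergences are for families indexed by $\varepsilon > 0$, as
   $\varepsilon \to 0$. *)
Definition weak_cvg (R : realType) (M : mesh R)
    (u : R -> R -> R) (u0 : R -> R) : Prop :=
  forall phi, L2x M phi -> ipx M (u e) phi @[e --> 0^'+] --> ipx M u0 phi.

Definition strong_cvg (R : realType) (M : mesh R)
    (u : R -> R -> R) (u0 : R -> R) : Prop :=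
  normx M (fun x => u e x - u0 x) @[e --> 0^'+] --> (0 : R).

(* The values at the mesh nodes are left free, as for $L^2$ classes; only the
   one-sided traces below matter there. *)
Definition in_Uh (R : realType) (M : mesh R) (k : nat) (u : R -> R) : Prop :=
  forall i : 'I_(nelt M), exists p : {poly R},
    (size p <= k.+1)%N /\ forall x, cell_int i x -> u x = p.[x].

Definition in_Uhv (R : realType) (M : mesh R) (k : nat) (m : velocity_model)
    (g : R -> R -> R) : Prop :=
  (forall v, Omega_v R m v -> in_Uh M k (g^~ v)) /\
  (forall (i : 'I_(nelt M)) x, cell_int i x -> L2v m (g x)).

Definition is_pi_h (R : realType) (M : mesh R) (k : nat) (f u : R -> R) : Prop :=
  in_Uh M k u /\ forall phi, in_Uh M k phi -> ipx M u phi = ipx M f phi.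

(* Traces at the left end point of [cell M i]. By periodicity, the left limit at
   the first node is the one at the right end point of the last cell
   ([ord_pred] is the cyclic predecessor). *)
Definition trace_r (R : realType) (M : mesh R) (u : R -> R)
    (i : 'I_(nelt M)) : R :=
  lim (u x @[x --> (node M i)^'+]).

Definition trace_l (R : realType) (M : mesh R) (u : R -> R)
    (i : 'I_(nelt M)) : R :=
  lim (u x @[x --> (node M (ord_pred i).+1)^'-]).

Definition jump (R : realType) (M : mesh R) (u : R -> R)
    (i : 'I_(nelt M)) : R :=
  trace_r u i - trace_l u i.

Definition mean (R : realType) (M : mesh R) (u : R -> R)
    (i : 'I_(nelt M)) : R :=
  2^-1 * (trace_r u i + trace_l u i).

Definition flux_q (R : realType) (fl : flux_pair) (M : mesh R) (q : R -> R)
    (i : 'I_(nelt M)) : R :=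
  match fl with
  | LeftRight => trace_l q i
  | RightLeft => trace_r q i
  | Central => mean q i
  end.

Definition flux_rho (R : realType) (fl : flux_pair) (M : mesh R) (rho : R -> R)
    (i : 'I_(nelt M)) : R :=
  match fl with
  | LeftRight => trace_r rho i
  | RightLeft => trace_l rho i
  | Central => mean rho i
  end.

Definition upwind (R : realType) (M : mesh R) (v : R) (u : R -> R)
    (i : 'I_(nelt M)) : R :=
  v * mean u i - `|v| / 2 * jump u i.

Definition vmoment (R : realType) (m : velocity_model) (g : R -> R -> R) :
    R -> R :=
  fun x => avg m (fun v => v * g x v).

Definition a_h (R : realType) (M : mesh R) (m : velocity_model)
    (fl : flux_pair) (g : R -> R -> R) (phi : R -> R) : R :=
  - (\sum_(i < nelt M)
       \int[@lebesgue_measure R]_(x in cell i) (vmoment m g x * derive1 phi x))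
  - \sum_(i < nelt M) flux_q fl (vmoment m g) i * jump phi i.

Definition d_h (R : realType) (M : mesh R) (fl : flux_pair)
    (rho psi : R -> R) : R :=
  \sum_(i < nelt M)
     \int[@lebesgue_measure R]_(x in cell i) (rho x * derive1 psi x)
  + \sum_(i < nelt M) flux_rho fl rho i * jump psi i.

Definition is_D_h (R : realType) (M : mesh R) (k : nat) (u : R -> R) (v : R)
    (D : R -> R) : Prop :=
  in_Uh M k D /\
  forall psi, in_Uh M k psi ->
    ipx M D psi =
      - (\sum_(i < nelt M)
           \int[@lebesgue_measure R]_(x in cell i) (v * u x * derive1 psi x))
      - \sum_(i < nelt M) upwind v u i * jump psi i.

(* [is_D_h] determines its argument on [Omega_x M] up to the values at the
   nodes, so the choice made by [xget] is immaterial. *)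
Definition D_h (R : realType) (M : mesh R) (k : nat) (g : R -> R -> R)
    (v : R) : R -> R :=
  xget (fun=> 0) [set D | is_D_h M k (g^~ v) v D].

Definition b_hv (R : realType) (M : mesh R) (k : nat) (m : velocity_model)
    (v : R) (g : R -> R -> R) (psi : R -> R) : R :=
  ipx M (fun x => D_h M k g v x - avg m (fun w => D_h M k g w x)) psi.

Definition DG_IMEX1 (R : realType) (M : mesh R) (k : nat) (m : velocity_model)
    (fl : flux_pair) (dt e : R)
    (rho : nat -> R -> R) (g : nat -> R -> R -> R) : Prop :=
  forall n : nat,
  [/\ in_Uh M k (rho n),
      in_Uhv M k m (g n),
      forall phi, in_Uh M k phi ->
        ipx M (fun x => (rho n.+1 x - rho n x) / dt) phi
        + a_h M m fl (g n) phi = 0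
    & forall psi, in_Uh M k psi -> forall v, Omega_v R m v ->
        ipx M (fun x => (g n.+1 x v - g n x v) / dt) psi
        + 1 / e * b_hv M k m v (g n) psi
        - v / e ^+ 2 * d_h M fl (rho n.+1) psi
        = - (1 / e ^+ 2) * ipx M (g n.+1 ^~ v) psi].

Definition trace_inverse_const (R : realType) (k : nat) (C : R) : Prop :=
  forall (a b : R) (w : {poly R}), a < b -> (size w <= k.+1)%N ->
  forall y, y = a \/ y = b ->
    `|w.[y]| ^+ 2 * (b - a) <=
    C * \int[@lebesgue_measure R]_(x in `[a, b]) (w.[x] ^+ 2).

Definition inverse_const (R : realType) (k : nat) (C : R) : Prop :=
  forall (a b : R) (w : {poly R}), a < b -> (size w <= k.+1)%N ->
    (b - a) ^+ 2 *
      \int[@lebesgue_measure R]_(x in `[a, b]) (`|w^`().[x]| ^+ 2) <=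
    C * \int[@lebesgue_measure R]_(x in `[a, b]) (w.[x] ^+ 2).

Definition alpha1 (R : realType) (m : velocity_model) (Chat : R) : R :=
  (vsup R m ^+ 2 + avg m (fun v => v ^+ 2)) * Chat.

Definition alpha2 (R : realType) (m : velocity_model) (C : R) : R :=
  2 * (vsup R m + avg m (fun v => `|v|)) * C.

Definition alpha3 (R : realType) (m : velocity_model) (C : R) : R :=
  2 * vsup R m * C.

Definition dt_stab (R : realType) (M : mesh R) (m : velocity_model)
    (C Chat c0 e : R) : R :=
  hx M / (alpha1 m Chat + alpha2 m C * alpha3 m C) *
  ((1 - c0) * hx M +
   Num.min e ((1 - c0) * alpha2 m C * hx M / alpha1 m Chat) * alpha3 m C).

(* Main.v *)
(* The mesh and the time step are fixed, so everything happens in the finite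
   dimensional space U_h. An element of U_h is determined by its values at
   k + 1 interior points of each cell, the forms of the scheme are linear in
   these values, and the dual basis beta_J of the evaluation at the J-th point
   turns the scheme into a recursion for nodal values. The microscopic equation
   gives
     <|(g^{n+1}, psi) - v d_h(rho^{n+1}, psi)|> = O(eps),
   where the constant depends on the L1-in-v size of g^n and on the bound of
   rho^{n+1}. By induction on n, rho^n and <v g^n> converge and g^n stays
   bounded as eps -> 0, and averaging the estimate against v gives
   q^{n+1} = <v^2> d_h(rho^{n+1}, .). At n = 0 the projections commute with the
   velocity average by Fubini. *)
Require Import Defs.
From HB Require Import structures.
From mathcomp Require Import all_boot all_order all_algebra.
From mathcomp Require Import all_classical all_reals all_analysis.
From mathcomp Require Import measurable_realfun qpoly ring lra.

Set Implicit Arguments.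
Unset Strict Implicit.
Unset Printing Implicit Defensive.

Import Order.TTheory GRing.Theory Num.Theory.
Import numFieldNormedType.Exports.

Local Open Scope classical_set_scope.
Local Open Scope ring_scope.

(** * Integration and the Fubini theorem for real-valued integrals *)

(** The initial data need not be well prepared: g^0 may have no limit at all, since the hypotheses
    give only the convergence of its first velocity moment and a bound. What is carried through a
    time step is therefore a triple: nodal limits of rho^n, nodal limits of <v g^n>, and a bound on
    g^n, with constants that may depend on n, on the time step and on the mesh. One step damps the
    unknown part of g^n because the relaxation term is implicit: after multiplication by eps^2 dt,
    the unknown g^{n+1} has the coefficient eps^2 + dt, which is at least dt, whereas g^n comes with
    eps^2 and the transport term with eps dt. Only relaxation and v d_h keep the factor dt, so they
    must balance in the limit. *)

Section Rintegral_extra.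
Context d (T : measurableType d) (R : realType).
Variable mu : {measure set T -> \bar R}.
Implicit Types (D : set T) (f g : T -> R).

Lemma integrable_Rsum D (I : Type) (s : seq I) (f : I -> T -> R) :
  measurable D -> (forall i, mu.-integrable D (EFin \o f i)) ->
  mu.-integrable D (EFin \o (fun x => \sum_(i <- s) f i x)).
Proof.
move=> mD fi; apply: (eq_integrable mD (fun x => \sum_(i <- s) (f i x)%:E)%E).
  by move=> x _ /=; rewrite sumEFin.
by apply: integrable_sum => // i _; exact: fi.
Qed.

Lemma integrable_RZl D (c : R) f : measurable D ->
  mu.-integrable D (EFin \o f) ->
  mu.-integrable D (EFin \o (fun x => c * f x)).
Proof.
move=> mD fi; apply: (eq_integrable mD (fun x => c%:E * (EFin \o f) x)%E).
  by move=> x _ /=; rewrite EFinM.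
exact: integrableZl.
Qed.

Lemma Rintegral_sum D (I : Type) (s : seq I) (f : I -> T -> R) :
  measurable D -> (forall i, mu.-integrable D (EFin \o f i)) ->
  \int[mu]_(x in D) (\sum_(i <- s) f i x) =
  \sum_(i <- s) \int[mu]_(x in D) f i x.
Proof.
move=> mD fi; elim: s => [|i s IH].
  rewrite big_nil; under eq_Rintegral do rewrite big_nil.
  by rewrite Rintegral_cst// mul0r.
rewrite big_cons -IH -RintegralD//; last exact: integrable_Rsum.
by under eq_Rintegral do rewrite big_cons.
Qed.

Lemma ae_eq_Rintegral D f g : measurable D ->
  measurable_fun D f -> measurable_fun D g ->
  {ae mu, forall x, D x -> f x = g x} ->
  \int[mu]_(x in D) f x = \int[mu]_(x in D) g x.
Proof.
move=> mD mf mg fg; congr fine; apply: ae_eq_integral => //.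
- exact/measurable_EFinP.
- exact/measurable_EFinP.
- by apply: filterS fg => x /[apply] /= ->.
Qed.

Lemma ae_le_Rintegral D f g : measurable D ->
  mu.-integrable D (EFin \o f) -> mu.-integrable D (EFin \o g) ->
  (forall x, D x -> 0 <= f x) -> (forall x, D x -> 0 <= g x) ->
  {ae mu, forall x, D x -> f x <= g x} ->
  \int[mu]_(x in D) f x <= \int[mu]_(x in D) g x.
Proof.
move=> mD fi gi f0 g0 fg; apply: fine_le.
- exact: integrable_fin_num.
- exact: integrable_fin_num.
- apply: ae_ge0_le_integral => //.
  + exact: measurable_int fi.
  + exact: measurable_int gi.
Qed.

Lemma integrableM_bounded D f (g : T -> R) (K : R) : measurable D ->
  mu.-integrable D (EFin \o f) -> measurable_fun D g ->
  (forall x, D x -> `|g x| <= K) ->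
  mu.-integrable D (EFin \o (fun x => f x * g x)).
Proof.
move=> mD fi mg gK.
apply: (@le_integrable _ _ _ _ _ mD _ (fun x => (K * f x)%:E)).
- apply/measurable_EFinP; apply: measurable_funM => //.
  exact/measurable_EFinP/(measurable_int _ fi).
- move=> x Dx /=; rewrite lee_fin normrM mulrC [leRHS]normrM.
  by apply: ler_wpM2r => //; exact: le_trans (gK _ Dx) (ler_norm _).
- exact: integrable_RZl.
Qed.

(** The pointwise bound [|f| <= 1 + f^2] suffices on a set of finite measure, without
    Cauchy-Schwarz. *)
Lemma square_integrable_integrable D f : measurable D -> (mu D < +oo)%E ->
  measurable_fun D f -> mu.-integrable D (fun x => (f x ^+ 2)%:E) ->
  mu.-integrable D (EFin \o f).
Proof.
move=> mD muD mf fi.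
apply: (@le_integrable _ _ _ _ _ mD _ (fun x => (1 + f x ^+ 2)%:E)).
- exact/measurable_EFinP.
- move=> x Dx /=; rewrite lee_fin [leRHS]ger0_norm ?addr_ge0 ?sqr_ge0//.
  rewrite -(real_normK (num_real (f x))).
  have := sqr_ge0 (`|f x| - 1); have := normr_ge0 (f x); nra.
- apply: (eq_integrable mD (fun x => (cst 1%:E x + (f x ^+ 2)%:E)%E)) => //.
  apply: integrableD => //.
  apply: (@measurable_bounded_integrable _ _ _ _ (cst 1)) => //.
  exact: bounded_cst.
Qed.

End Rintegral_extra.

Section Rfubini.
Context d1 d2 (T1 : measurableType d1) (T2 : measurableType d2) (R : realType).
Variables (m1 : {sigma_finite_measure set T1 -> \bar R}).
Variables (m2 : {sigma_finite_measure set T2 -> \bar R}).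
Variables (D1 : set T1) (D2 : set T2) (f : T1 -> T2 -> R).
Hypotheses (mD1 : measurable D1) (mD2 : measurable D2).
Hypothesis fi : (m1 \x m2)%E.-integrable (D1 `*` D2)
  (fun z => (f z.1 z.2)%:E).

(** Extension by zero: the Fubini theorem is applied on the whole product space, and its slices are
    then restricted back to [D1] and [D2]. *)
Let F : T1 * T2 -> \bar R := (fun z => (f z.1 z.2)%:E) \_ (D1 `*` D2).

Let FT : (m1 \x m2)%E.-integrable setT F.
Proof. exact: (iffLR (integrable_mkcond _ (measurableX mD1 mD2)) fi). Qed.

Let F1 x : (fun y => F (x, y)) =
  if x \in D1 then (fun y => (f x y)%:E) \_ D2 else cst 0%E.
Proof.
apply/funext => y; rewrite /F /patch in_setX/=.
by case: (x \in D1).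
Qed.

Let F2 y : (fun x => F (x, y)) =
  if y \in D2 then (fun x => (f x y)%:E) \_ D1 else cst 0%E.
Proof.
apply/funext => x; rewrite /F /patch in_setX/= andbC.
by case: (y \in D2).
Qed.

Lemma ae_integrable_snd :
  {ae m2, forall y, D2 y -> m1.-integrable D1 (EFin \o f^~ y)}.
Proof.
apply: filterS (ae_integrable2 FT) => y + D2y.
by rewrite F2 mem_set// => /(integrable_mkcond _ mD1).
Qed.

Lemma ae_integrable_fst :
  {ae m1, forall x, D1 x -> m2.-integrable D2 (EFin \o f x)}.
Proof.
apply: filterS (ae_integrable1 FT) => x + D1x.
by rewrite F1 mem_set// => /(integrable_mkcond _ mD2).
Qed.

Let integral_fst x : (\int[m2]_y F (x, y) =
  ((fun x => \int[m2]_(y in D2) (f x y)%:E) \_ D1) x)%E.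
Proof.
rewrite F1 [RHS]/patch; case: ifP => _.
  by rewrite -integral_mkcond.
by rewrite integral_cst// mul0e.
Qed.

Let integral_snd y : (\int[m1]_x F (x, y) =
  ((fun y => \int[m1]_(x in D1) (f x y)%:E) \_ D2) y)%E.
Proof.
rewrite F2 [RHS]/patch; case: ifP => _.
  by rewrite -integral_mkcond.
by rewrite integral_cst// mul0e.
Qed.

Let integrable_fst :
  m1.-integrable D1 (fun x => \int[m2]_(y in D2) (f x y)%:E)%E.
Proof.
apply/integrable_mkcond => //.
have := integrable_fubini_F FT; apply: eq_integrable => // x _.
by rewrite /fubini_F integral_fst.
Qed.

(** Since the integral of a slice is at most the integral of its absolute value, Tonelli bounds the
    outer integral. *)
Let integrable_snd :
  m2.-integrable D2 (fun y => \int[m1]_(x in D1) (f x y)%:E)%E.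
Proof.
apply/integrable_mkcond => //.
suff : m2.-integrable setT (fubini_G m1 F).
  by apply: eq_integrable => // y _; rewrite /fubini_G integral_snd.
have mF := measurable_int _ FT.
have mF2 y : measurable_fun setT (fun x => F (x, y)).
  exact: measurableT_comp.
apply/integrableP; split; first exact: (measurable_fubini_G FT).
apply: le_lt_trans ((integrable21ltyP m1 m2 mF).1 FT).
apply: ge0_le_integral => //.
- by apply: measurableT_comp => //; exact: (measurable_fubini_G FT).
- apply: (@measurable_fun_fubini_tonelli_G _ _ _ _ _ m1 (abse \o F)) => //=.
  exact: measurableT_comp.
- by move=> y _; exact: le_abse_integral.
Qed.

(** [fine] sends both infinities to 0 and so never increases an absolute value; hence slices that
    fail to be integrable need no separate treatment. *)
Lemma integrable_Rintegral_fst :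
  m1.-integrable D1 (EFin \o (fun x => \int[m2]_(y in D2) f x y)).
Proof.
have mf := measurable_int _ integrable_fst.
have /integrableP[_ fy] := integrable_fst; apply/integrableP; split.
  by apply/measurable_EFinP; apply: measurableT_comp mf.
apply: le_lt_trans fy; apply: ge0_le_integral => //.
- apply: measurableT_comp => //; apply/measurable_EFinP.
  exact: measurableT_comp mf.
- exact: measurableT_comp mf.
- move=> x _ /=; rewrite /Rintegral.
  by case: (\int[m2]_(y in D2) _)%E => //= *; rewrite normr0 leey.
Qed.

Lemma integrable_Rintegral_snd :
  m2.-integrable D2 (EFin \o (fun y => \int[m1]_(x in D1) f x y)).
Proof.
have mf := measurable_int _ integrable_snd.
have /integrableP[_ fy] := integrable_snd; apply/integrableP; split.
  by apply/measurable_EFinP; apply: measurableT_comp mf.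
apply: le_lt_trans fy; apply: ge0_le_integral => //.
- apply: measurableT_comp => //; apply/measurable_EFinP.
  exact: measurableT_comp mf.
- exact: measurableT_comp mf.
- move=> x _ /=; rewrite /Rintegral.
  by case: (\int[m1]_(y in D1) _)%E => //= *; rewrite normr0 leey.
Qed.

(** The inner [fine] can be removed only on integrable slices. These are almost all slices, so both
    outer integrals are first compared almost everywhere with their extended-real versions. *)
Lemma Rintegral_Fubini :
  \int[m1]_(x in D1) \int[m2]_(y in D2) f x y =
  \int[m2]_(y in D2) \int[m1]_(x in D1) f x y.
Proof.
transitivity (fine (\int[m1]_(x in D1) \int[m2]_(y in D2) (f x y)%:E)%E).
{ congr fine; apply: ae_eq_integral => //.
  - exact: measurable_int integrable_Rintegral_fst.
  - exact: measurable_int integrable_fst.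
  - apply: filterS ae_integrable_fst => x /[apply] fxi /=.
    by rewrite fineK//; exact: integrable_fin_num. }
transitivity (fine (\int[m2]_(y in D2) \int[m1]_(x in D1) (f x y)%:E)%E).
  congr fine; rewrite integral_mkcond [RHS]integral_mkcond.
  transitivity (\int[m1]_x \int[m2]_y F (x, y))%E.
    by apply: eq_integral => x _; rewrite integral_fst.
  by rewrite (Fubini FT); apply: eq_integral => y _; rewrite integral_snd.
congr fine; apply: ae_eq_integral => //.
- exact: measurable_int integrable_snd.
- exact: measurable_int integrable_Rintegral_snd.
- apply: filterS ae_integrable_snd => x /[apply] fxi /=.
  by rewrite fineK//; exact: integrable_fin_num.
Qed.

End Rfubini.

(** * The mesh and nodal coordinates *)

Section Mesh.
Variables (R : realType) (M : mesh R).

Notation N := (nelt M).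
Notation leb := (@lebesgue_measure R).

Lemma hx_gt0 : 0 < hx M.
Proof.
by rewrite /hx divr_gt0 ?subr_gt0 ?xmin_lt_xmax// ltr0n nelt_gt0.
Qed.

Lemma nodeS j : node M j.+1 = node M j + hx M.
Proof. by rewrite /node -natr1 mulrDl mul1r addrA. Qed.

Lemma node_ltS j : node M j < node M j.+1.
Proof. by rewrite nodeS ltrDl hx_gt0. Qed.

Lemma ler_node i j : (i <= j)%N -> node M i <= node M j.
Proof.
by move=> ij; rewrite /node lerD2l ler_wpM2r ?ler_nat// ltW ?hx_gt0.
Qed.

Lemma node0 : node M 0 = xmin M.
Proof. by rewrite /node mul0r addr0. Qed.

Lemma node_nelt : node M N = xmax M.
Proof.
rewrite /node /hx mulrCA divff ?mulr1; last by rewrite pnatr_eq0 -lt0n nelt_gt0.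
by rewrite addrC subrK.
Qed.

Lemma Omega_xE : Omega_x M = `[node M 0, node M N]%classic.
Proof. by rewrite node0 node_nelt. Qed.

Lemma measurable_Omega_x : measurable (Omega_x M : set (measurableTypeR R)).
Proof. exact: measurable_itv. Qed.

Lemma Omega_x_fin : (leb (Omega_x M) < +oo)%E.
Proof.
by rewrite lebesgue_measure_itv/=; case: ifP; rewrite -?EFinB ltry.
Qed.

Lemma cell_sub_Omega_x (i : 'I_N) : cell i `<=` Omega_x M.
Proof.
move=> x; rewrite Omega_xE /cell /= !in_itv /= => /andP[ix xi].
by rewrite (le_trans (ler_node (leq0n i)) ix) (le_trans xi)// ler_node.
Qed.

Lemma cell_int_sub_cell (i : 'I_N) : cell_int i `<=` cell i.
Proof.
by move=> x; rewrite /cell_int /cell /= !in_itv /= => /andP[/ltW -> /ltW ->].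
Qed.

Lemma cell_int_sub_Omega_x (i : 'I_N) : cell_int i `<=` Omega_x M.
Proof. by move=> x /cell_int_sub_cell/cell_sub_Omega_x. Qed.

Lemma cell_int_inj (i j : 'I_N) x : cell_int i x -> cell_int j x -> i = j.
Proof.
rewrite /cell_int /= !in_itv /= => /andP[ix xi] /andP[jx xj].
apply/val_inj/eqP; rewrite eqn_leq /=; apply/andP; split; rewrite leqNgt;
  apply/negP => /ler_node h.
- by have := lt_trans (lt_le_trans xj h) ix; rewrite ltxx.
- by have := lt_trans (lt_le_trans xi h) jx; rewrite ltxx.
Qed.

Let itvS n : `[node M 0, node M n.+1]%classic =
  `[node M 0, node M n]%classic `|`
  (`]node M n, node M n.+1[%classic `|` [set node M n.+1]).
Proof.
apply/seteqP; split => x; rewrite /= !in_itv /=.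
- move=> /andP[h0 h1].
  case: (lerP x (node M n)) => h2; first by left; rewrite h0.
  right; move: h1; rewrite le_eqVlt => /orP[/eqP ->|->]; [by right | by left].
- move=> [/andP[-> h]|[/andP[h1 h2]|->]] /=.
  + exact: le_trans h (ltW (node_ltS n)).
  + by rewrite (le_trans (ler_node (leq0n n)) (ltW h1)) ltW.
  + by rewrite lexx ler_node.
Qed.

Lemma Omega_x_cover x : Omega_x M x ->
  (exists i : 'I_N, cell_int i x) \/ exists2 j, (j < N.+1)%N & x = node M j.
Proof.
rewrite Omega_xE; have : (N <= N)%N by [].
(* The induction is on the number of leading cells only; the bound by the true cell count is kept so
   that cell n can be named as an ordinal. *)
elim: {1 3}N => [_|n IH nN].
  by rewrite set_itv1 => ->; right; exists 0%N.
rewrite itvS => -[/(IH (ltnW nN))//|[xn|->]]; last by right; exists n.+1.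
by left; exists (Ordinal nN).
Qed.

Lemma negligible_nodes : leb.-negligible (range (node M)).
Proof.
have c : countable (range (node M)) by exact/card_image_le.
exists (range (node M)); split => //; last exact: countable_lebesgue_measure0.
exact: countable_measurable.
Qed.

(** Membership in U_h says nothing at the mesh nodes; these are countably many, so identities known
    in the open cells still pass under integrals. *)
Lemma ae_cell_int (P : R -> Prop) :
  (forall (i : 'I_N) x, cell_int i x -> P x) ->
  {ae leb, forall x, Omega_x M x -> P x}.
Proof.
move=> HP; apply: negligibleS negligible_nodes => x /= /not_implyP[Ox nPx].
by have [[i /HP//]|[j _ ->]] := Omega_x_cover Ox; exists j.
Qed.

(** The values at the mesh nodes are arbitrary, but every function is measurable on a singleton. *)
Lemma measurable_fun_cell (f : R -> R) :
  (forall i : 'I_N, measurable_fun (cell_int i : set (measurableTypeR R)) f) ->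
  measurable_fun (Omega_x M : set (measurableTypeR R)) f.
Proof.
move=> mf; rewrite Omega_xE; have : (N <= N)%N by [].
elim: {1 3}N => [_|n IH nN].
  by rewrite set_itv1; exact: measurable_fun_set1.
rewrite itvS.
apply/measurable_funU; [exact: measurable_itv|exact: measurableU|].
split; first exact: IH (ltnW nN).
apply/measurable_funU; [exact: measurable_itv|exact: measurable_set1|].
by split; [exact: (mf (Ordinal nN))|exact: measurable_fun_set1].
Qed.

End Mesh.

(** * Functions that agree with a polynomial on an open interval *)

Section PolyEq.
Variable R : realType.

Lemma derive1_eq_horner (u : R -> R) (p : {poly R}) a b x : x \in `]a, b[ ->
  (forall y, y \in `]a, b[ -> u y = p.[y]) -> derive1 u x = p^`().[x].
Proof.
move=> xab up; rewrite derive1E -(@derive_val _ _ _ x 1 (horner p) p^`().[x]).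
apply: near_eq_derive => //.
by near=> y; apply: up; near: y; exact: near_in_itvoo.
Unshelve. all: by end_near. Qed.

Lemma lim_right_horner (u : R -> R) (p : {poly R}) a b : a < b ->
  (forall y, y \in `]a, b[ -> u y = p.[y]) -> lim (u x @[x --> a^'+]) = p.[a].
Proof.
move=> ab up; apply: cvg_lim => //.
apply: (@cvg_trans _ (p.[x] @[x --> a^'+])).
  apply: near_eq_cvg; near=> y; rewrite up// in_itv /=; apply/andP; split.
    by near: y; exact: nbhs_right_gt.
  by near: y; exact: nbhs_right_lt.
by apply: cvg_at_right_filter; exact: continuous_horner.
Unshelve. all: by end_near. Qed.

Lemma lim_left_horner (u : R -> R) (p : {poly R}) a b : a < b ->
  (forall y, y \in `]a, b[ -> u y = p.[y]) -> lim (u x @[x --> b^'-]) = p.[b].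
Proof.
move=> ab up; apply: cvg_lim => //.
apply: (@cvg_trans _ (p.[x] @[x --> b^'-])).
  apply: near_eq_cvg; near=> y; rewrite up// in_itv /=; apply/andP; split.
    by near: y; exact: nbhs_left_gt.
  by near: y; exact: nbhs_left_lt.
by apply: cvg_at_left_filter; exact: continuous_horner.
Unshelve. all: by end_near. Qed.

Lemma integrable_poly (p : {poly R}) a b :
  (@lebesgue_measure R).-integrable `[a, b] (EFin \o horner p).
Proof.
apply: continuous_compact_integrable; first exact: segment_compact.
by apply: continuous_subspaceT => x; exact: continuous_horner.
Qed.

Lemma horner_bounded (p : {poly R}) a b :
  exists K, forall x, x \in `[a, b] -> `|p.[x]| <= K.
Proof.
have := @compact_bounded R R^o (horner p @` `[a, b]).
move=> /(_ _)[].
  apply: continuous_compact; last exact: segment_compact.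
  by apply: continuous_subspaceT => x; exact: continuous_horner.
move=> K [_ HK]; exists (K + 1) => x xab.
by apply: (HK (K + 1)); [rewrite ltrDl|exists x].
Qed.

End PolyEq.

Section Coordinates.
Variables (R : realType) (M : mesh R) (k : nat).

Notation N := (nelt M).
Notation leb := (@lebesgue_measure R).
Notation idx := ('I_N * 'I_k.+1)%type.

(* Interpolation nodes are interior to the cell: elements of U_h are
   unconstrained at the mesh nodes. *)
Definition sample (i j : nat) : R := node M i + j.+1%:R / k.+2%:R * hx M.

Lemma sample_inj i : injective (sample i).
Proof.
move=> j1 j2 /addrI/(mulIf (lt0r_neq0 (hx_gt0 M))).
move=> /(mulIf (invr_neq0 _)); rewrite pnatr_eq0 => /(_ isT)/eqP.
by rewrite eqr_nat => /eqP[].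
Qed.

Definition xpt (I : idx) : R := sample I.1 I.2.

Lemma cell_int_xpt I : cell_int I.1 (xpt I).
Proof.
rewrite /cell_int /= in_itv /= nodeS /xpt /sample ltrDl ltrD2l.
rewrite mulr_gt0 ?hx_gt0 ?divr_gt0 ?ltr0n//=.
by rewrite gtr_pMl ?hx_gt0// ltr_pdivrMr// mul1r ltr_nat ltnS.
Qed.

Definition lag (i : 'I_N) (j : 'I_k.+1) : {poly R} :=
  tnth (lagrange k.+1 (sample i)) j.

Lemma lag_xpt i j l : (lag i j).[xpt (i, l)] = (j == l)%:R.
Proof. by rewrite /lag lagrange_sample//; exact: sample_inj. Qed.

(** The interpolant at the sample points of the cell. For u in U_h it is the polynomial piece that
    [in_Uh] only asserts to exist, now given by a formula linear in the nodal values. *)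
Definition loc (u : R -> R) (i : 'I_N) : {poly R} :=
  \sum_(j < k.+1) u (xpt (i, j)) *: lag i j.

Lemma size_loc u i : (size (loc u i) <= k.+1)%N.
Proof.
apply: (leq_trans (size_sum _ _ _)); apply/bigmax_leqP => j _.
apply: (leq_trans (size_scale_leq _ _)).
by rewrite size_lagrange_//; exact: sample_inj.
Qed.

Lemma in_Uh_loc u (i : 'I_N) x : in_Uh M k u -> cell_int i x ->
  u x = (loc u i).[x].
Proof.
move=> /(_ i)[p [sp up]] ix; rewrite up//; congr horner.
rewrite {1}(@lagrange_gen _ k.+1 (sample i) isT (@sample_inj i) p sp).
apply: eq_bigr => j _; rewrite mul_polyC up//.
exact: (cell_int_xpt (i, j)).
Qed.

(** Nodal basis of U_h, extended by zero outside the open cell, so that it also vanishes at all mesh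
    nodes. *)
Definition bas (I : idx) (x : R) : R :=
  if `[< cell_int I.1 x >] then (lag I.1 I.2).[x] else 0.

Definition expand (c : idx -> R) (x : R) : R := \sum_I c I * bas I x.

Lemma expand_in c (i : 'I_N) x : cell_int i x ->
  expand c x = (\sum_(j < k.+1) c (i, j) *: lag i j).[x].
Proof.
move=> ix; rewrite /expand horner_sum.
rewrite (eq_bigr (fun I => c (I.1, I.2) * bas (I.1, I.2) x)); last by case.
rewrite -(pair_bigA _ (fun i j => c (i, j) * bas (i, j) x))/=.
rewrite (bigD1 i)//= [X in _ + X]big1 ?addr0.
  by apply: eq_bigr => j _; rewrite hornerZ /bas /= asboolT.
move=> l li; apply: big1 => j _; rewrite /bas /= asboolF ?mulr0// => lx.
by rewrite (cell_int_inj lx ix) eqxx in li.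
Qed.

Lemma expand_Uh c : in_Uh M k (expand c).
Proof.
move=> i; exists (\sum_(j < k.+1) c (i, j) *: lag i j); split; last first.
  by move=> x; exact: expand_in.
apply: (leq_trans (size_sum _ _ _)); apply/bigmax_leqP => j _.
apply: (leq_trans (size_scale_leq _ _)).
by rewrite size_lagrange_//; exact: sample_inj.
Qed.

Lemma expand_xpt c I : expand c (xpt I) = c I.
Proof.
case: I => i l; rewrite (expand_in _ (cell_int_xpt (i, l))) horner_sum /=.
rewrite (bigD1 l)//= [X in _ + X]big1 ?addr0; last first.
  by move=> j jl; rewrite hornerZ lag_xpt (negbTE jl) mulr0.
by rewrite hornerZ lag_xpt eqxx mulr1.
Qed.

Lemma Uh_expand u (i : 'I_N) x : in_Uh M k u -> cell_int i x ->
  u x = expand (u \o xpt) x.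
Proof. by move=> uU ix; rewrite (expand_in _ ix) (in_Uh_loc uU ix). Qed.

Lemma Uh_measurable u : in_Uh M k u ->
  measurable_fun (Omega_x M : set (measurableTypeR R)) u.
Proof.
move=> uU; apply: measurable_fun_cell => i.
apply: (@eq_measurable_fun _ _ _ _ _ (horner (loc u i))).
  by move=> x /set_mem ix; rewrite (in_Uh_loc uU ix).
exact: measurable_poly.
Qed.

Lemma bas_bounded I : exists K, forall x, `|bas I x| <= K.
Proof.
have [K HK] := horner_bounded (lag I.1 I.2) (node M I.1) (node M I.1.+1).
exists (Num.max K 0) => x; rewrite /bas; case: asboolP => [ix|_].
  by rewrite le_max HK//; exact: cell_int_sub_cell.
by rewrite normr0 le_max lexx orbT.
Qed.

Lemma bas_Uh I : in_Uh M k (bas I).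
Proof.
move=> i; have [iI|iI] := eqVneq I.1 i.
  exists (lag I.1 I.2); split.
    by rewrite size_lagrange_//; exact: sample_inj.
  by move=> x ix; rewrite /bas asboolT// iI.
exists 0; split; first by rewrite size_poly0.
move=> x ix; rewrite horner0 /bas asboolF// => Ix.
by rewrite (cell_int_inj Ix ix) eqxx in iI.
Qed.

End Coordinates.

(** * Functionals that are linear in the nodal values *)

(** A square matrix with trivial left kernel is invertible; the finite type is enumerated only to
    reach matrices over ordinals. *)
Lemma gram_inverse (R : fieldType) (I : finType) (G : I -> I -> R) :
  (forall c : I -> R,
    (forall J, \sum_I c I * G I J = 0) -> forall I, c I = 0) ->
  exists B : I -> I -> R, forall I J, \sum_K B J K * G I K = (I == J)%:R.
Proof.
move=> Ginj.
pose A : 'M[R]_#|I| := \matrix_(a, b) G (enum_val a) (enum_val b).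
have uA : A \in unitmx.
  rewrite unitmxE unitfE; apply/negP => /det0P[v v0 vA]; move/eqP: v0; apply.
  apply/rowP => a; rewrite mxE -(enum_valK a).
  apply: (Ginj (fun I => v 0 (enum_rank I))) => J.
  have /rowP/(_ (enum_rank J)) := vA; rewrite !mxE => vAJ; rewrite -[RHS]vAJ.
  rewrite (reindex (@enum_val I I))/=; last first.
    by exists enum_rank => x _; rewrite ?enum_valK ?enum_rankK.
  by apply: eq_bigr => b _; rewrite mxE enum_rankK enum_valK.
(* The indices are transposed because the sum runs over the second index of G: it is the entry (I,
   J) of A times its inverse. *)
exists (fun J K => invmx A (enum_rank K) (enum_rank J)) => i j.
have /matrixP/(_ (enum_rank i) (enum_rank j)) := mulmxV uA.
rewrite !mxE (inj_eq enum_rank_inj) => <-.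
rewrite (reindex (@enum_val I I))/=; last first.
  by exists enum_rank => x _; rewrite ?enum_valK ?enum_rankK.
by apply: eq_bigr => b _; rewrite mxE enum_rankK enum_valK mulrC.
Qed.

Section CoordLinear.
Variables (R : realType) (M : mesh R) (k : nat).

Notation N := (nelt M).
Notation leb := (@lebesgue_measure R).
Notation idx := ('I_N * 'I_k.+1)%type.
Notation xpt := (@xpt R M k).
Notation Uh := (in_Uh M k).

(** Linearity on U_h, which is a predicate and not a vector space type here. Fixing the coefficients
    also gives continuity with respect to nodal convergence and the exchange with velocity averages,
    and demands nothing of F outside U_h. *)
Definition coord_linear (F : (R -> R) -> R) :=
  exists K : idx -> R, forall u, Uh u -> F u = \sum_I u (xpt I) * K I.

Lemma coord_linear_ext (F G : (R -> R) -> R) :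
  (forall u, Uh u -> F u = G u) -> coord_linear G -> coord_linear F.
Proof. by move=> FG [K HK]; exists K => u uU; rewrite FG// HK. Qed.

Lemma coord_linearD (F G : (R -> R) -> R) : coord_linear F -> coord_linear G ->
  coord_linear (fun u => F u + G u).
Proof.
move=> [K HK] [L HL]; exists (fun I => K I + L I) => u uU.
by rewrite HK// HL// -big_split; apply: eq_bigr => I _; rewrite mulrDr.
Qed.

Lemma coord_linearZ c (F : (R -> R) -> R) : coord_linear F ->
  coord_linear (fun u => c * F u).
Proof.
move=> [K HK]; exists (fun I => c * K I) => u uU.
by rewrite HK// mulr_sumr; apply: eq_bigr => I _; rewrite mulrCA.
Qed.

Lemma coord_linearN (F : (R -> R) -> R) : coord_linear F ->
  coord_linear (fun u => - F u).
Proof.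
move=> /(coord_linearZ (-1)); apply: coord_linear_ext => u _.
by rewrite mulN1r.
Qed.

Lemma coord_linearB (F G : (R -> R) -> R) : coord_linear F -> coord_linear G ->
  coord_linear (fun u => F u - G u).
Proof. by move=> F1 /coord_linearN; exact: coord_linearD. Qed.

Lemma coord_linearMr c (F : (R -> R) -> R) : coord_linear F ->
  coord_linear (fun u => F u * c).
Proof.
move=> /(coord_linearZ c); apply: coord_linear_ext => u _.
by rewrite mulrC.
Qed.

Lemma coord_linear_sum (T : Type) (s : seq T) (F : T -> (R -> R) -> R) :
  (forall i, coord_linear (F i)) -> coord_linear (fun u => \sum_(i <- s) F i u).
Proof.
move=> HF; elim: s => [|i s IH].
  by exists (fun=> 0) => u _; rewrite big_nil big1// => I _; rewrite mulr0.
apply: coord_linear_ext (coord_linearD (HF i) IH) => u _.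
by rewrite big_cons.
Qed.

(** The coefficients are the values of L on the Lagrange polynomials of cell i, and 0 in the other
    cells. Traces and cell integrals are brought to this form by factoring them through [loc]. *)
Lemma coord_linear_loc (i : 'I_N) (L : {poly R} -> R) :
  (forall a p q, L (a *: p + q) = a * L p + L q) ->
  coord_linear (fun u => L (loc k u i)).
Proof.
move=> Llin.
have L0 : L 0 = 0.
  have /eqP := Llin 1 0 0.
  by rewrite scaler0 addr0 mul1r -subr_eq subrr eq_sym => /eqP.
exists (fun I : idx => (I.1 == i)%:R * L (lag i I.2)) => u uU.
pose f l j := u (xpt (l, j)) * ((l == i)%:R * L (lag i j)).
rewrite (eq_bigr (fun I : idx => f I.1 I.2)); last by case.
rewrite -(pair_bigA _ f) /f /=.
rewrite (bigD1 i)//= [X in _ + X]big1 ?addr0; last first.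
  by move=> l li; apply: big1 => j _; rewrite (negbTE li) mul0r mulr0.
rewrite eqxx /loc; elim: (index_enum _) => [|j s IH]; first by rewrite !big_nil.
by rewrite !big_cons Llin IH mul1r.
Qed.

Lemma coord_linear_lin F u w a b : coord_linear F -> Uh u -> Uh w ->
  Uh (fun x => a * u x + b * w x) ->
  F (fun x => a * u x + b * w x) = a * F u + b * F w.
Proof.
move=> [K HK] uU wU U; rewrite !HK// !mulr_sumr -big_split.
by apply: eq_bigr => I _ /=; rewrite mulrDl !mulrA.
Qed.

Lemma Uh_lin u w a b : Uh u -> Uh w -> Uh (fun x => a * u x + b * w x).
Proof.
move=> uU wU i; have [p [sp up]] := uU i; have [q [sq wq]] := wU i.
exists (a *: p + b *: q); split.
  rewrite (leq_trans (size_polyD _ _))// geq_max.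
  by rewrite !(leq_trans (size_scale_leq _ _)).
by move=> x ix; rewrite hornerD !hornerZ up// wq.
Qed.

Lemma UhZ u a : Uh u -> Uh (fun x => a * u x).
Proof.
move=> uU i; have [p [sp up]] := Uh_lin a 0 uU uU i; exists p; split=> // x.
by move=> /up <-; rewrite mul0r addr0.
Qed.

Lemma coord_linear_Z F u a : coord_linear F -> Uh u ->
  F (fun x => a * u x) = a * F u.
Proof.
move=> [K HK] uU; rewrite !HK//; last exact: UhZ.
by rewrite mulr_sumr; apply: eq_bigr => I _; rewrite mulrA.
Qed.

Lemma trace_rE u (i : 'I_N) : Uh u -> trace_r u i = (loc k u i).[node M i].
Proof.
move=> uU; apply: (lim_right_horner (node_ltS M i)) => y yi.
by rewrite (@in_Uh_loc _ M k u i).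
Qed.

Lemma trace_lE u (i : 'I_N) : Uh u ->
  trace_l u i = (loc k u (ord_pred i)).[node M (ord_pred i).+1].
Proof.
move=> uU; apply: (lim_left_horner (node_ltS M (ord_pred i))) => y yi.
by rewrite (@in_Uh_loc _ M k u (ord_pred i)).
Qed.

Lemma coord_linear_trace_r (i : 'I_N) : coord_linear (fun u => trace_r u i).
Proof.
apply: (coord_linear_ext (fun u => @trace_rE u i)).
apply: (@coord_linear_loc _ (fun p => p.[node M i])) => a p q.
by rewrite hornerD hornerZ.
Qed.

Lemma coord_linear_trace_l (i : 'I_N) : coord_linear (fun u => trace_l u i).
Proof.
apply: (coord_linear_ext (fun u => @trace_lE u i)).
apply: (@coord_linear_loc _ (fun p => p.[node M (ord_pred i).+1])) => a p q.
by rewrite hornerD hornerZ.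
Qed.

Lemma coord_linear_jump (i : 'I_N) : coord_linear (fun u => jump u i).
Proof.
exact: coord_linearB (coord_linear_trace_r i) (coord_linear_trace_l i).
Qed.

Lemma coord_linear_mean (i : 'I_N) : coord_linear (fun u => mean u i).
Proof.
apply: coord_linearZ.
exact: coord_linearD (coord_linear_trace_r i) (coord_linear_trace_l i).
Qed.

Lemma coord_linear_flux_q fl (i : 'I_N) : coord_linear (fun u => flux_q fl u i).
Proof.
case: fl; [exact: coord_linear_trace_l|exact: coord_linear_trace_r|].
exact: coord_linear_mean.
Qed.

Lemma coord_linear_flux_rho fl (i : 'I_N) :
  coord_linear (fun u => flux_rho fl u i).
Proof.
case: fl; [exact: coord_linear_trace_r|exact: coord_linear_trace_l|].
exact: coord_linear_mean.
Qed.

(** At the end points of the closed cell, u and [derive1 phi] are uncontrolled. Both integrals are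
    reduced to the open cell, where the polynomial pieces can be substituted. *)
Lemma cell_integralE u phi (i : 'I_N) : Uh u -> Uh phi ->
  \int[leb]_(x in cell i) (u x * derive1 phi x) =
  \int[leb]_(x in cell i) ((loc k u i) * (loc k phi i)^`()).[x].
Proof.
move=> uU pU; congr fine.
have e x : x \in `]node M i, node M i.+1[ ->
    u x * derive1 phi x = ((loc k u i) * (loc k phi i)^`()).[x].
  move=> xi; rewrite hornerM (@in_Uh_loc _ M k u i)//; congr (_ * _).
  apply: (derive1_eq_horner xi) => y yi.
  by rewrite (@in_Uh_loc _ M k phi i).
have mp := @measurable_poly R ((loc k u i) * (loc k phi i)^`()).
rewrite /cell [LHS]integral_itv_bndoo; last first.
  apply/measurable_EFinP; apply: eq_measurable_fun (mp _).
  by move=> x /set_mem xi; rewrite e.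
rewrite [RHS]integral_itv_bndoo; last by apply/measurable_EFinP; exact: mp.
by apply: eq_integral => x /set_mem xi; rewrite e.
Qed.

Let Rint_lin (i : 'I_N) a (p q : {poly R}) :
  \int[leb]_(x in cell i) (a *: p + q).[x] =
  a * \int[leb]_(x in cell i) p.[x] + \int[leb]_(x in cell i) q.[x].
Proof.
under eq_Rintegral do rewrite hornerD hornerZ.
rewrite RintegralD ?RintegralZl//; try exact: measurable_itv.
all: rewrite /cell; try exact: integrable_poly.
by apply: integrable_RZl; [exact: measurable_itv|exact: integrable_poly].
Qed.

Lemma coord_linear_cell_l phi (i : 'I_N) : Uh phi ->
  coord_linear (fun u => \int[leb]_(x in cell i) (u x * derive1 phi x)).
Proof.
move=> pU; apply: coord_linear_ext => [u uU|].
  exact: cell_integralE uU pU.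
apply: (@coord_linear_loc _ (fun p =>
  \int[leb]_(x in cell i) (p * (loc k phi i)^`()).[x])) => a p q.
by rewrite mulrDl -scalerAl Rint_lin.
Qed.

Lemma coord_linear_cell_r u (i : 'I_N) : Uh u ->
  coord_linear (fun phi => \int[leb]_(x in cell i) (u x * derive1 phi x)).
Proof.
move=> uU; apply: coord_linear_ext => [phi pU|].
  exact: cell_integralE uU pU.
apply: (@coord_linear_loc _ (fun p =>
  \int[leb]_(x in cell i) (loc k u i * p^`()).[x])) => a p q.
by rewrite derivD derivZ mulrDr -scalerAr Rint_lin.
Qed.

Lemma coord_linear_a_q fl phi : Uh phi -> coord_linear (fun q =>
  \sum_(i < N) \int[leb]_(x in cell i) (q x * derive1 phi x)
  + \sum_(i < N) flux_q fl q i * jump phi i).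
Proof.
move=> pU; apply: coord_linearD; apply: coord_linear_sum => i.
- exact: coord_linear_cell_l.
- apply: coord_linearMr; exact: coord_linear_flux_q.
Qed.

Lemma coord_linear_d_h fl psi : Uh psi ->
  coord_linear (fun rho => d_h M fl rho psi).
Proof.
move=> pU; apply: coord_linearD; apply: coord_linear_sum => i.
- exact: coord_linear_cell_l.
- apply: coord_linearMr; exact: coord_linear_flux_rho.
Qed.

Lemma ipxC u w : ipx M u w = ipx M w u.
Proof. by apply: eq_Rintegral => x _; rewrite mulrC. Qed.

Lemma L2x_integrable phi : L2x M phi ->
  leb.-integrable (Omega_x M) (EFin \o phi).
Proof.
move=> [mp ip]; apply: square_integrable_integrable => //.
- exact: measurable_Omega_x.
- exact: Omega_x_fin.
Qed.

(** The second factor is any L2 function, not only an element of U_h; this is what turns nodal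
    convergence into weak convergence in L2. *)
Lemma ipx_coord u phi : Uh u -> L2x M phi ->
  ipx M u phi = \sum_I u (xpt I) * ipx M (@bas R M k I) phi.
Proof.
move=> uU p2; have mO := @measurable_Omega_x R M; have [mp _] := p2.
have bi (I : idx) :
    leb.-integrable (Omega_x M) (EFin \o (fun x => bas I x * phi x)).
  have [K HK] := @bas_bounded R M k I.
  have := integrableM_bounded mO (L2x_integrable p2)
    (Uh_measurable (bas_Uh I)) (fun x _ => HK x).
  by apply: eq_integrable => // x _ /=; rewrite mulrC.
transitivity (\int[leb]_(x in Omega_x M)
    \sum_I u (xpt I) * (bas I x * phi x)); last first.
  rewrite Rintegral_sum//; last first.
    by move=> I; apply: integrable_RZl.
  by apply: eq_bigr => I _; rewrite RintegralZl.
apply: ae_eq_Rintegral => //.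
- apply: measurable_funM => //; exact: Uh_measurable.
- have si := integrable_Rsum (index_enum idx) mO
    (fun I => integrable_RZl (u (xpt I)) mO (bi I)).
  by move/measurable_int/measurable_EFinP : si.
- apply: ae_cell_int => i x ix.
  rewrite (Uh_expand uU ix) /expand mulr_suml.
  by apply: eq_bigr => I _; rewrite mulrA.
Qed.

Lemma coord_linear_ipx phi : L2x M phi -> coord_linear (fun u => ipx M u phi).
Proof.
move=> p2; exists (fun I => ipx M (@bas R M k I) phi) => u uU.
exact: ipx_coord.
Qed.

Lemma Uh_bounded u : Uh u ->
  exists K, forall x, Omega_x M x -> `|u x| <= K.
Proof.
move=> uU.
have /choice[B HB] : forall I : idx, exists K, forall x, `|bas I x| <= K.
  by move=> I; exact: bas_bounded.
pose K1 := \sum_I `|u (xpt I)| * B I.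
(* The values of u at the mesh nodes are unconstrained, but only N + 1 nodes lie in the domain. *)
pose K2 := \sum_(j < N.+1) `|u (node M j)|.
have K10 : 0 <= K1.
  by apply: sumr_ge0 => I _; rewrite mulr_ge0// (le_trans _ (HB I 0)).
have K20 : 0 <= K2 by apply: sumr_ge0.
exists (K1 + K2) => x /Omega_x_cover[[i ix]|[j jN ->]].
  rewrite (Uh_expand uU ix); apply: le_trans (ler_norm_sum _ _ _) _.
  apply: ler_wpDr => //; apply: ler_sum => I _.
  by rewrite normrM ler_wpM2l.
apply: ler_wpDl => //; rewrite /K2 (bigD1 (Ordinal jN))//=.
by rewrite lerDl sumr_ge0.
Qed.

Lemma Uh_L2x u : Uh u -> L2x M u.
Proof.
move=> uU; have mO := @measurable_Omega_x R M; have mu := Uh_measurable uU.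
split => //; have [K HK] := Uh_bounded uU.
suff : leb.-integrable (Omega_x M) (EFin \o (fun x => u x ^+ 2)) by [].
apply: measurable_bounded_integrable => //.
- exact: Omega_x_fin.
- exact: measurable_funX.
- exists (K ^+ 2); split; first exact: num_real.
  move=> L /ltW KL x Ox /=; apply: le_trans KL.
  by rewrite normrX lerXn2r ?nnegrE// ?HK// (le_trans _ (HK x Ox)).
Qed.

Lemma coord_linear_ipx_Uh phi : Uh phi -> coord_linear (fun u => ipx M u phi).
Proof. by move=> /Uh_L2x; exact: coord_linear_ipx. Qed.

Lemma ipx_ge0 u : 0 <= ipx M u u.
Proof.
apply: fine_ge0; apply: integral_ge0 => x _.
by rewrite lee_fin -expr2 sqr_ge0.
Qed.

End CoordLinear.

(** * Dual basis and Riesz representation *)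

Section DualBasis.
Variables (R : realType) (M : mesh R) (k : nat) (C : R).
Hypothesis C_inv : trace_inverse_const k C.

Notation N := (nelt M).
Notation leb := (@lebesgue_measure R).
Notation idx := ('I_N * 'I_k.+1)%type.
Notation xpt := (@xpt R M k).
Notation Uh := (in_Uh M k).
Notation bas := (@bas R M k).

(* The trace inequality on [y, b], b the right end of the cell, bounds the
   value at the interior node y by the L2 norm. *)
Lemma ipx_eq0 u : Uh u -> ipx M u u = 0 -> forall I : idx, u (xpt I) = 0.
Proof.
move=> uU u0 I; set p := loc k u I.1; set y := xpt I; set b := node M I.1.+1.
have mO := @measurable_Omega_x R M.
have := cell_int_xpt I; rewrite /cell_int /= in_itv /= -/y -/b => /andP[ay yb].
have sub : `]y, b[ `<=` cell_int I.1.
  move=> x; rewrite /cell_int /= !in_itv /= => /andP[yx ->].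
  by rewrite (lt_trans ay yx).
have pE : \int[leb]_(x in `[y, b]) (p.[x] ^+ 2) =
    \int[leb]_(x in `]y, b[) (u x * u x).
  congr fine; rewrite integral_itv_bndoo; last first.
    apply/measurable_EFinP; apply: measurable_funX; exact: measurable_poly.
  apply: eq_integral => x /set_mem/sub xi.
  by rewrite -expr2 (in_Uh_loc uU xi).
have mu2 : measurable_fun (Omega_x M : set (measurableTypeR R))
    (fun x => (u x * u x)%:E).
  by apply/measurable_EFinP; apply: measurable_funM; exact: Uh_measurable uU.
(* A vanishing real integral could also be [fine] of an infinite one; square integrability of u
   excludes this. *)
have I0 : (\int[leb]_(x in Omega_x M) (u x * u x)%:E)%E = 0%E.
  have [_ ui] := Uh_L2x uU.
  rewrite -[LHS]fineK; first by congr EFin; exact: u0.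
  by apply: integrable_fin_num.
have J0 : \int[leb]_(x in `]y, b[) (u x * u x) = 0.
  rewrite /Rintegral.
  have -> // : (\int[leb]_(x in `]y, b[) (u x * u x)%:E)%E = 0%E.
  apply/eqP; rewrite eq_le integral_ge0 ?andbT; last first.
    by move=> x _; rewrite lee_fin -expr2 sqr_ge0.
  rewrite -I0; apply: ge0_subset_integral => //.
    by move=> x _; rewrite lee_fin -expr2 sqr_ge0.
  by move=> x /sub; exact: cell_int_sub_Omega_x.
have := C_inv yb (size_loc k u I.1) (or_introl erefl).
rewrite -/p pE J0 mulr0 -(in_Uh_loc uU (cell_int_xpt I)) pmulr_lle0 ?subr_gt0//.
move=> h; apply/eqP; rewrite -normr_eq0 -[_ == 0]sqrf_eq0.
by rewrite eq_le h sqr_ge0.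
Qed.

Lemma ipx_bas u : Uh u -> forall w, Uh w ->
  ipx M u w = \sum_I u (xpt I) * ipx M (bas I) w.
Proof. by move=> uU w wU; apply: ipx_coord => //; exact: Uh_L2x wU. Qed.

(** The Gram matrix of [bas] has no kernel: if c is in the kernel, [expand c] is orthogonal to every
    basis function, hence to itself, and vanishes at the nodes by [ipx_eq0]. *)
Lemma dual_basis : exists beta : idx -> R -> R, (forall J, Uh (beta J)) /\
  forall J u, Uh u -> ipx M u (beta J) = u (xpt J).
Proof.
have [|B HB] := @gram_inverse R idx (fun I J => ipx M (bas I) (bas J)).
  move=> c c0 I; rewrite -(expand_xpt c I); have cU := expand_Uh c.
  apply: ipx_eq0 => //; rewrite (ipx_bas cU cU); apply: big1 => J _.
  rewrite ipxC (ipx_bas cU); last exact: bas_Uh.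
  under eq_bigr do rewrite expand_xpt.
  by rewrite c0 mulr0.
exists (fun J => expand (B J)); split=> [J|J u uU]; first exact: expand_Uh.
have bU := expand_Uh (B J).
rewrite (ipx_bas uU bU) (bigD1 J)//= [X in _ + X]big1 ?addr0.
  rewrite ipxC (ipx_bas bU (bas_Uh J)).
  have := HB J J; rewrite eqxx => hb.
  rewrite (eq_bigr (fun K => B J K * ipx M (bas J) (bas K))) ?hb ?mulr1//.
  by move=> K _; rewrite expand_xpt ipxC.
move=> I IJ; rewrite ipxC (ipx_bas bU (bas_Uh I)).
have := HB I J; rewrite (negbTE IJ) => hb.
rewrite (eq_bigr (fun K => B J K * ipx M (bas I) (bas K))) ?hb ?mulr0//.
by move=> K _; rewrite expand_xpt ipxC.
Qed.

(** The nodal value of D at J has to be [ipx M D (beta J) = F (beta J)], which leaves a single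
    candidate. *)
Lemma coord_linear_riesz F : coord_linear M k F ->
  exists D, Uh D /\ forall psi, Uh psi -> ipx M D psi = F psi.
Proof.
move=> [K HK]; have [beta [bU bE]] := dual_basis.
have DU := expand_Uh (fun J => F (beta J)).
exists (expand (fun J => F (beta J))); split=> // psi pU.
rewrite (ipx_bas DU pU).
under eq_bigr do rewrite expand_xpt HK// mulr_suml.
rewrite exchange_big /= HK//; apply: eq_bigr => I _.
rewrite -(bE I psi pU) ipxC (ipx_bas (bU I) pU) mulr_suml.
(* The nodal values of the dual basis form a symmetric matrix: [beta J] at [xpt I] and [beta I] at
   [xpt J] both equal the inner product of [beta I] and [beta J]. *)
apply: eq_bigr => J _; rewrite -(bE I _ (bU J)) ipxC (bE J _ (bU I)).
by rewrite mulrAC.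
Qed.

Definition D_rhs (u : R -> R) (v : R) (psi : R -> R) : R :=
  - (\sum_(i < N) \int[leb]_(x in cell i) (v * u x * derive1 psi x))
  - \sum_(i < N) upwind v u i * jump psi i.

Lemma coord_linear_D_rhs u v : Uh u -> coord_linear M k (D_rhs u v).
Proof.
move=> uU; apply: coord_linearB; first apply: coord_linearN.
  by apply: coord_linear_sum => i; apply: coord_linear_cell_r; exact: UhZ.
by apply: coord_linear_sum => i; apply: coord_linearZ; exact: coord_linear_jump.
Qed.

(** Existence of the representative is what makes the choice by [xget] a genuine solution rather
    than the default zero function. *)
Lemma D_hP (g : R -> R -> R) v : Uh (g^~ v) ->
  is_D_h M k (g^~ v) v (D_h M k g v).
Proof.
move=> gU; have [D [DU DE]] := coord_linear_riesz (coord_linear_D_rhs v gU).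
by apply: (@xgetPex _ (fun=> 0) [set D | is_D_h M k (g^~ v) v D]); exists D.
Qed.

(** The upwind flux is not linear in v, but it depends on v only through the factors v and |v|. With
    functionals free of v, integrability in v and bounds uniform over |v| <= 1 follow. *)
Lemma D_rhs_split psi : Uh psi -> exists F1 F2,
  [/\ coord_linear M k F1, coord_linear M k F2 &
      forall u v, Uh u -> D_rhs u v psi = v * F1 u + `|v| * F2 u].
Proof.
move=> pU.
exists (fun u => - (\sum_(i < N) \int[leb]_(x in cell i) (u x * derive1 psi x))
   - \sum_(i < N) mean u i * jump psi i).
exists (fun u => \sum_(i < N) (2^-1 * jump u i) * jump psi i).
split.
- apply: coord_linearB; first apply: coord_linearN.
    by apply: coord_linear_sum => i; exact: coord_linear_cell_l.
  apply: coord_linear_sum => i; apply: coord_linearMr; exact: coord_linear_mean.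
- apply: coord_linear_sum => i; apply: coord_linearMr; apply: coord_linearZ.
  exact: coord_linear_jump.
- move=> u v uU; rewrite /D_rhs.
  under eq_bigr do rewrite (coord_linear_Z v (coord_linear_cell_l _ pU) uU).
  rewrite -mulr_sumr.
  have -> : \sum_(i < N) upwind v u i * jump psi i =
      v * (\sum_(i < N) mean u i * jump psi i)
      - `|v| * \sum_(i < N) 2^-1 * jump u i * jump psi i.
    by rewrite !mulr_sumr -sumrB; apply: eq_bigr => i _; rewrite /upwind; field.
  by ring.
Qed.

End DualBasis.

(** * Velocity averages and the microscopic estimate *)

Section Velocity.
Variables (R : realType) (m : velocity_model).

Notation Ov := (Omega_v R m).
Implicit Types (f g : R -> R) (c : R).

Definition vint (f : R -> R) := (mu_v m).-integrable Ov (EFin \o f).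

Lemma measurable_Omega_v : measurable (Ov : set (measurableTypeR R)).
Proof.
rewrite /Omega_v; case: m; last exact: measurable_itv.
by apply: measurableU; exact: measurable_set1.
Qed.

Lemma Omega_v_le1 v : Ov v -> `|v| <= 1.
Proof.
rewrite /Omega_v; case: m => /=; last by rewrite in_itv /= -ler_norml.
by move=> [->|->]; rewrite ?normrN normr1.
Qed.

Lemma mu_v_fin : (mu_v m Ov < +oo)%E.
Proof.
rewrite -ge0_fin_numE ?measure_ge0//; apply: fin_num_measure.
exact: measurable_Omega_v.
Qed.

Let mO := measurable_Omega_v.

Lemma vint_eq f g : (forall v, Ov v -> f v = g v) -> vint f -> vint g.
Proof.
by move=> fg; apply: eq_integrable => // v /set_mem Ovv /=; rewrite fg.
Qed.

Lemma vint_L2v f : L2v m f -> vint f.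
Proof.
by move=> [mf fi]; apply: square_integrable_integrable => //; exact: mu_v_fin.
Qed.

Lemma vint_cst c : vint (fun=> c).
Proof.
apply: measurable_bounded_integrable => //; first exact: mu_v_fin.
exact: bounded_cst.
Qed.

Lemma vintD f g : vint f -> vint g -> vint (fun v => f v + g v).
Proof.
move=> fi gi; have := integrableD mO fi gi.
by apply: eq_integrable => // v _ /=; rewrite EFinD.
Qed.

Lemma vintZ c f : vint f -> vint (fun v => c * f v).
Proof. exact: integrable_RZl. Qed.

Lemma vintB f g : vint f -> vint g -> vint (fun v => f v - g v).
Proof.
move=> fi /(vintZ (-1)) /(vintD fi).
by apply: vint_eq => v _; rewrite mulN1r.
Qed.

Lemma vint_sum (T : Type) (s : seq T) (f : T -> R -> R) :
  (forall i, vint (f i)) -> vint (fun v => \sum_(i <- s) f i v).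
Proof. by move=> fi; exact: integrable_Rsum. Qed.

Lemma vint_norm f : vint f -> vint (fun v => `|f v|).
Proof. by move=> /integrable_norm. Qed.

Lemma vintM_v f : vint f -> vint (fun v => v * f v).
Proof.
move=> fi; have := integrableM_bounded mO fi (@measurable_id _ _ _) Omega_v_le1.
by apply: vint_eq => v _; rewrite mulrC.
Qed.

Lemma vintM_normv f : vint f -> vint (fun v => `|v| * f v).
Proof.
move=> fi.
have h (v : R) : Ov v -> `| `|v| | <= 1 by rewrite normr_id; exact: Omega_v_le1.
have := integrableM_bounded mO fi (@normr_measurable _ _) h.
by apply: vint_eq => v _; rewrite mulrC.
Qed.

Lemma avg_eq f g : (forall v, Ov v -> f v = g v) -> avg m f = avg m g.
Proof. by move=> fg; apply: eq_Rintegral => v /set_mem/fg. Qed.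

Lemma avgD f g : vint f -> vint g ->
  avg m (fun v => f v + g v) = avg m f + avg m g.
Proof. exact: RintegralD. Qed.

Lemma avgB f g : vint f -> vint g ->
  avg m (fun v => f v - g v) = avg m f - avg m g.
Proof. exact: RintegralB. Qed.

Lemma avgZ c f : vint f -> avg m (fun v => c * f v) = c * avg m f.
Proof. exact: RintegralZl. Qed.

Lemma avg_sum (T : Type) (s : seq T) (f : T -> R -> R) :
  (forall i, vint (f i)) ->
  avg m (fun v => \sum_(i <- s) f i v) = \sum_(i <- s) avg m (f i).
Proof. exact: Rintegral_sum. Qed.

Lemma le_avg f g : vint f -> vint g -> (forall v, Ov v -> f v <= g v) ->
  avg m f <= avg m g.
Proof. exact: le_Rintegral. Qed.

Lemma norm_avg f : vint f -> `|avg m f| <= avg m (fun v => `|f v|).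
Proof. exact: le_normr_Rintegral. Qed.

Lemma avg_ge0 f : (forall v, Ov v -> 0 <= f v) -> 0 <= avg m f.
Proof.
move=> f0; apply: fine_ge0; apply: integral_ge0 => v /f0.
by rewrite lee_fin.
Qed.

(** The total mass stays symbolic, which treats both velocity models at once. *)
Lemma avg_cst c : avg m (fun=> c) = c * avg m (fun=> 1).
Proof. by rewrite /avg !Rintegral_cst// mul1r. Qed.

End Velocity.

Section AvgCoordinates.
Variables (R : realType) (M : mesh R) (k : nat) (m : velocity_model).

Notation N := (nelt M).
Notation idx := ('I_N * 'I_k.+1)%type.
Notation xpt := (@xpt R M k).
Notation Uh := (in_Uh M k).
Notation Ov := (Omega_v R m).

(** Integrability in v is recorded at the interpolation points only: inside a cell, every slice
    [G x] is a combination of those slices with coefficients depending on x. *)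
Definition Uh_vint (G : R -> R -> R) :=
  (forall v, Ov v -> Uh (G^~ v)) /\ (forall I : idx, vint m (G (xpt I))).

Lemma in_Uhv_vint g : in_Uhv M k m g -> Uh_vint g.
Proof.
by move=> [gU gL]; split=> // I; apply: vint_L2v; apply: gL (cell_int_xpt I).
Qed.

Lemma Uh_vintM_v G : Uh_vint G -> Uh_vint (fun x v => v * G x v).
Proof.
move=> [GU Gi]; split; first by move=> v /GU; exact: UhZ.
by move=> I; exact: vintM_v.
Qed.

Lemma avg_Uh G : Uh_vint G -> Uh (fun x => avg m (G x)).
Proof.
move=> [GU Gi] i.
exists (\sum_(j < k.+1) avg m (G (xpt (i, j))) *: lag i j); split.
  apply: (leq_trans (size_sum _ _ _)); apply/bigmax_leqP => j _.
  apply: (leq_trans (size_scale_leq _ _)).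
  by rewrite size_lagrange_//; exact: sample_inj.
move=> x ix; rewrite horner_sum.
rewrite (@avg_eq _ _ _
  (fun v => \sum_(j < k.+1) (lag i j).[x] * G (xpt (i, j)) v)).
  rewrite avg_sum; last by move=> j; exact: vintZ.
  by apply: eq_bigr => j _; rewrite avgZ// hornerZ mulrC.
move=> v Ovv; rewrite (in_Uh_loc (GU v Ovv) ix) /loc horner_sum.
by apply: eq_bigr => j _; rewrite hornerZ mulrC.
Qed.

Lemma vint_coord_linear F G : coord_linear M k F -> Uh_vint G ->
  vint m (fun v => F (G^~ v)).
Proof.
move=> [K HK] [GU Gi].
apply: (@vint_eq _ _ (fun v => \sum_I K I * G (xpt I) v)).
  by move=> v /GU gU; rewrite HK//; apply: eq_bigr => I _; rewrite mulrC.
by apply: vint_sum => I; exact: vintZ.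
Qed.

(** Only a finite sum is exchanged with the velocity integral, so no joint measurability of G in (x,
    v) is involved. *)
Lemma avg_coord_linear F G : coord_linear M k F -> Uh_vint G ->
  avg m (fun v => F (G^~ v)) = F (fun x => avg m (G x)).
Proof.
move=> [K HK] GG; have [GU Gi] := GG; rewrite HK; last exact: avg_Uh.
rewrite (@avg_eq _ _ _ (fun v => \sum_I K I * G (xpt I) v)).
  rewrite avg_sum; last by move=> I; exact: vintZ.
  by apply: eq_bigr => I _; rewrite avgZ// mulrC.
by move=> v /GU gU; rewrite HK//; apply: eq_bigr => I _; rewrite mulrC.
Qed.

Lemma coord_linear_vmoment F g : coord_linear M k F -> Uh_vint g ->
  F (vmoment m g) = avg m (fun v => v * F (g^~ v)).
Proof.
move=> FL gU; rewrite /vmoment -(avg_coord_linear FL (Uh_vintM_v gU)).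
by apply: avg_eq => v Ovv; rewrite (coord_linear_Z v FL)//; exact: gU.1.
Qed.

Lemma vmoment_Uh g : Uh_vint g -> Uh (vmoment m g).
Proof. by move=> /Uh_vintM_v/avg_Uh. Qed.

(* An L1-in-v norm suffices: the scheme is only ever averaged against bounded
   functions of v. *)
Definition vmass (g : R -> R -> R) := \sum_I avg m (fun v => `|g (xpt I) v|).

Lemma vmass_ge0 g : 0 <= vmass g.
Proof. by apply: sumr_ge0 => I _; exact: avg_ge0. Qed.

Lemma avg_sum_norm g : Uh_vint g ->
  avg m (fun v => \sum_I `|g (xpt I) v|) = vmass g.
Proof. by move=> [_ gi]; apply: avg_sum => I; exact: vint_norm. Qed.

Lemma vint_sum_norm g : Uh_vint g -> vint m (fun v => \sum_I `|g (xpt I) v|).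
Proof. by move=> [_ gi]; apply: vint_sum => I; exact: vint_norm. Qed.

Lemma coord_linear_bound F : coord_linear M k F ->
  exists2 K, 0 <= K & forall u, Uh u -> `|F u| <= K * \sum_I `|u (xpt I)|.
Proof.
move=> [K HK]; exists (\sum_I `|K I|); first by apply: sumr_ge0.
move=> u uU; rewrite HK//; apply: le_trans (ler_norm_sum _ _ _) _.
rewrite mulr_sumr; apply: ler_sum => I _; rewrite normrM mulrC.
by apply: ler_wpM2r => //; rewrite (bigD1 I)//= lerDl sumr_ge0.
Qed.

Lemma D_rhs_bound psi : Uh psi -> exists2 K, 0 <= K &
  forall u v, Uh u -> `|v| <= 1 ->
    `|D_rhs M u v psi| <= K * \sum_I `|u (xpt I)|.
Proof.
move=> /D_rhs_split[F1 [F2 [+ + FE]]].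
move=> /coord_linear_bound[K1 K10 H1] /coord_linear_bound[K2 K20 H2].
exists (K1 + K2); first exact: addr_ge0.
move=> u v uU v1; rewrite FE// mulrDl.
apply: le_trans (ler_normD _ _) _; rewrite !normrM normr_id.
have := H1 u uU; have := H2 u uU; have := normr_ge0 v.
have := normr_ge0 (F1 u); have := normr_ge0 (F2 u).
by nra.
Qed.

Lemma vint_D_rhs g psi : Uh_vint g -> Uh psi ->
  vint m (fun v => D_rhs M (g^~ v) v psi).
Proof.
move=> gU /D_rhs_split[F1 [F2 [L1 L2 FE]]].
have h1 := vintM_v (vint_coord_linear L1 gU).
have h2 := vintM_normv (vint_coord_linear L2 gU).
apply: vint_eq (vintD h1 h2) => v Ovv; rewrite FE//; exact: gU.1.
Qed.

Section Scheme.
Variable C : R.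
Hypothesis C_inv : trace_inverse_const k C.

(** [D_h] is chosen separately for each v, so its dependence on v is not visible from its
    definition. Testing against [beta I] recovers its nodal values as [D_rhs], which is explicit in
    v. *)
Lemma D_h_Uh_vint g : Uh_vint g -> Uh_vint (fun x v => D_h M k g v x).
Proof.
move=> gU; have [beta [bU bE]] := dual_basis M C_inv; split.
  by move=> v /(gU.1)/(D_hP C_inv)[].
move=> I; apply: vint_eq (vint_D_rhs gU (bU I)) => v.
move=> /(gU.1)/(D_hP C_inv)[DU DE].
by rewrite -(bE I _ DU) DE.
Qed.

Lemma b_hvE g psi v : Uh_vint g -> Uh psi -> Ov v ->
  b_hv M k m v g psi =
  D_rhs M (g^~ v) v psi - avg m (fun w => D_rhs M (g^~ w) w psi).
Proof.
move=> gU pU Ovv; have DU := D_h_Uh_vint gU.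
have FL := coord_linear_ipx_Uh pU.
have [D1 DE] := D_hP C_inv (gU.1 v Ovv).
have AU := avg_Uh DU.
have DB := Uh_lin 1 (-1) D1 AU.
have {}DE : forall psi, Uh psi ->
  ipx M (D_h M k g v) psi = D_rhs M (g^~ v) v psi := DE.
rewrite /b_hv -(DE psi pU).
have -> : avg m (fun w => D_rhs M (g^~ w) w psi) =
    ipx M (fun x => avg m (fun w => D_h M k g w x)) psi.
  rewrite -(avg_coord_linear FL DU); apply: avg_eq => w /(gU.1)/(D_hP C_inv)[_].
  by move=> ->.
rewrite -[X in _ = X - _]mul1r -[X in _ = _ - X]mul1r -mulNr.
rewrite -(coord_linear_lin FL D1 AU DB); congr ipx; apply/funext => x.
by rewrite mul1r mulN1r.
Qed.

(* With P, P' the moments of g, g' against psi, d = d_h(rho', psi) and B the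
   b_hv term, the scheme reads
   (e^2 + dt) (P' - v d) = e^2 P - e dt B - e^2 v d. *)
Lemma micro_estimate fl dt psi : 0 < dt -> Uh psi -> exists2 K, 0 <= K &
  forall e g g' rho', 0 < e <= 1 -> Uh_vint g -> Uh_vint g' ->
  (forall v, Ov v ->
     ipx M (fun x => (g' x v - g x v) / dt) psi
     + 1 / e * b_hv M k m v g psi - v / e ^+ 2 * d_h M fl rho' psi
     = - (1 / e ^+ 2) * ipx M (g' ^~ v) psi) ->
  avg m (fun v => `|ipx M (g'^~ v) psi - v * d_h M fl rho' psi|)
  <= e * (K * (vmass g + `|d_h M fl rho' psi|)).
Proof.
move=> dt0 pU.
have FL := coord_linear_ipx_Uh pU.
have [Kp Kp0 HP] := coord_linear_bound FL.
have [Kd Kd0 HD] := D_rhs_bound pU.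
pose mu1 := avg m (fun=> 1 : R).
have mu10 : 0 <= mu1 by apply: avg_ge0.
have idt0 : 0 < dt^-1 by rewrite invr_gt0.
(* The first two terms come from the part of the pointwise bound [key] that varies with v; the
   factor [mu1] comes from averaging its constant part, made of the averaged transport term and |d|
   / dt. *)
exists (Kp / dt + Kd + (Kd + dt^-1) * mu1).
  by rewrite !(addr_ge0, mulr_ge0)// ltW.
move=> e g g' rho' /andP[e0 e1] gU gU' eqn.
set d := d_h M fl rho' psi in eqn *.
set A := avg m (fun w => D_rhs M (g^~ w) w psi).
have Ab : `|A| <= Kd * vmass g.
  apply: le_trans (norm_avg (vint_D_rhs gU pU)) _.
  rewrite -(avg_sum_norm gU) -avgZ; last exact: vint_sum_norm.
  apply: le_avg; first exact: vint_norm (vint_D_rhs gU pU).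
    exact/vintZ/vint_sum_norm.
  by move=> v Ovv; apply: HD; [exact: gU.1|exact: Omega_v_le1 Ovv].
have key v : Ov v -> `|ipx M (g'^~ v) psi - v * d| <=
    e * ((Kp / dt + Kd) * (\sum_I `|g (xpt I) v|) + (Kd * vmass g + `|d| / dt)).
  move=> Ovv; have := eqn v Ovv; rewrite (b_hvE gU pU Ovv) -/A.
  have [gv gv'] := (gU.1 v Ovv, gU'.1 v Ovv).
  have -> : (fun x => (g' x v - g x v) / dt) =
      (fun x => dt^-1 * g' x v + (- dt^-1) * g x v).
    by apply/funext => x; rewrite mulNr -mulrBr mulrC.
  rewrite (coord_linear_lin FL gv' gv); last exact: Uh_lin.
  have hP := HP _ gv; have hD := HD _ v gv (Omega_v_le1 Ovv).
  move: hP hD; set P' := ipx M (g'^~ v) psi; set P := ipx M (g^~ v) psi.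
  set D := D_rhs M _ _ _; set s := \sum_I _ => hP hD E.
  have den0 : 0 < e ^+ 2 + dt by rewrite ltr_wpDl ?sqr_ge0.
  (* The last factor is at most 1, so the estimate does not degenerate as e tends to 0. *)
  have E2 : P' - v * d =
      e * (e * (P / dt - v * d / dt) - (D - A)) * (dt / (e ^+ 2 + dt)).
    have E1 : (dt^-1 * P' + - dt^-1 * P + 1 / e * (D - A) - v / e ^+ 2 * d
        - (- (1 / e ^+ 2) * P')) * (e ^+ 2 * dt) =
        (e ^+ 2 + dt) * P' - (e ^+ 2 * P - e * dt * (D - A) + dt * (v * d)).
      by field; rewrite !gt_eqF.
    have : P' = (e ^+ 2 * P - e * dt * (D - A) + dt * (v * d)) / (e ^+ 2 + dt).
      move: E1; rewrite E subrr mul0r => /esym/eqP; rewrite subr_eq0 => /eqP <-.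
      by rewrite mulrC mulKf// gt_eqF.
    by move=> ->; field; rewrite !gt_eqF.
  rewrite E2 normrM normrM (gtr0_norm e0) -mulrA.
  apply: ler_wpM2l; first exact: ltW.
  have q1 : `|dt / (e ^+ 2 + dt)| <= 1.
    rewrite ger0_norm; last by apply: divr_ge0; exact: ltW.
    by rewrite ler_pdivrMr// mul1r lerDr sqr_ge0.
  apply: (@le_trans _ _ `|e * (P / dt - v * d / dt) - (D - A)|).
    by rewrite ler_piMr.
  apply: le_trans (ler_normB _ _) _; rewrite normrM (gtr0_norm e0).
  have h1 : `|P / dt - v * d / dt| <= Kp / dt * s + `|d| / dt.
    apply: le_trans (ler_normB _ _) _; apply: lerD.
      rewrite normrM (gtr0_norm idt0) mulrAC.
      by apply: ler_wpM2r => //; exact: ltW.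
    rewrite !normrM (gtr0_norm idt0); apply: ler_wpM2r; first exact: ltW.
    by apply: ler_piMl => //; exact: Omega_v_le1 Ovv.
  have h2 : `|D - A| <= Kd * s + Kd * vmass g.
    by apply: le_trans (ler_normB _ _) _; exact: lerD.
  (* The second power of e is given up, using e <= 1. *)
  have h3 : e * `|P / dt - v * d / dt| <= `|P / dt - v * d / dt|.
    by apply: ler_piMl.
  apply: le_trans (lerD (le_trans h3 h1) h2) _.
  by rewrite mulrDl; lra.
have vi : vint m (fun v => ipx M (g'^~ v) psi - v * d).
  apply: vintB; first exact: (vint_coord_linear FL gU').
  by apply: vintM_v; exact: vint_cst.
have si := vint_sum_norm gU.
apply: (le_trans (le_avg (vint_norm vi) _ key)).
  by apply: vintZ; apply: vintD; [exact: vintZ|exact: vint_cst].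
rewrite avgZ; last by apply: vintD; [exact: vintZ|exact: vint_cst].
apply: ler_wpM2l; first exact: ltW.
rewrite avgD ?avgZ ?avg_sum_norm//; [|exact: vintZ|exact: vint_cst].
rewrite avg_cst -/mu1.
have v0 := vmass_ge0 g.
have n0 := normr_ge0 d.
(* Expanding K times the sum on the right leaves exactly three nonnegative cross terms that do not
   occur on the left. *)
have p1 := mulr_ge0 (addr_ge0 (mulr_ge0 Kp0 (ltW idt0)) Kd0) n0.
have p2 := mulr_ge0 (mulr_ge0 Kd0 mu10) n0.
have p3 := mulr_ge0 (mulr_ge0 (ltW idt0) mu10) v0.
by lra.
Qed.

End Scheme.

End AvgCoordinates.

(** * Projected initial data *)

Section InitialData.
Variables (R : realType) (M : mesh R) (k : nat) (m : velocity_model).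

Notation N := (nelt M).
Notation leb := (@lebesgue_measure R).
Notation idx := ('I_N * 'I_k.+1)%type.
Notation xpt := (@xpt R M k).
Notation Uh := (in_Uh M k).
Notation Ox := (Omega_x M).
Notation Ov := (Omega_v R m).

Variables (G g : R -> R -> R).
Hypothesis G2 : L2xv M m G.
Hypothesis gU : Uh_vint M k m g.
Hypothesis gG : {ae mu_v m, forall v, Ov v -> is_pi_h M k (G ^~ v) (g ^~ v)}.

Let mOx := @measurable_Omega_x R M.
Let mOv := @measurable_Omega_v R m.

Let int_fst (f : R -> R -> R) := @integrable_Rintegral_fst _ _
  (measurableTypeR R) (measurableTypeR R) R leb (mu_v m) Ox Ov f mOx mOv.
Let int_snd (f : R -> R -> R) := @integrable_Rintegral_snd _ _
  (measurableTypeR R) (measurableTypeR R) R leb (mu_v m) Ox Ov f mOx mOv.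
Let ae_fst (f : R -> R -> R) := @ae_integrable_fst _ _
  (measurableTypeR R) (measurableTypeR R) R leb (mu_v m) Ox Ov f mOx mOv.
Let ae_snd (f : R -> R -> R) := @ae_integrable_snd _ _
  (measurableTypeR R) (measurableTypeR R) R leb (mu_v m) Ox Ov f mOx mOv.
Let fubini (f : R -> R -> R) := @Rintegral_Fubini _ _
  (measurableTypeR R) (measurableTypeR R) R leb (mu_v m) Ox Ov f mOx mOv.

Let G1 : (leb \x mu_v m)%E.-integrable (Ox `*` Ov)
  (EFin \o (fun z : R * R => G z.1 z.2)).
Proof.
have [mG iG] := G2; apply: square_integrable_integrable => //.
- exact: measurableX.
- rewrite [X in (X < _)%E](_ : _ = (leb Ox * mu_v m Ov)%E); last first.
    exact: product_measure1E.
  apply: lte_mul_pinfty => //.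
  + by rewrite ge0_fin_numE//; exact: Omega_x_fin.
  + exact: mu_v_fin.
Qed.

Let aeG2 : {ae mu_v m, forall v, Ov v -> L2x M (G^~ v)}.
Proof.
have [mG iG] := G2.
have h1 := @ae_snd G G1.
have h2 := @ae_snd (fun x v => G x v ^+ 2) iG.
apply: (@filterS2 _ _ (ae_filter_ringOfSetsType (mu_v m)) _ _ _ _ h1 h2).
move=> v f1 f2 Ovv; split; last exact: (f2 Ovv).
by move/measurable_int/measurable_EFinP : (f1 Ovv).
Qed.

Lemma ae_ipx_pi phi : Uh phi ->
  {ae mu_v m, forall v, Ov v -> ipx M (g^~ v) phi = ipx M (G^~ v) phi}.
Proof.
move=> pU.
apply: (@filterS _ _ (ae_filter_ringOfSetsType (mu_v m)) _ _ _ gG) => v.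
by move=> /[apply] -[_]; exact.
Qed.

Lemma ipx_vmoment_initial phi : Uh phi ->
  ipx M (vmoment m g) phi = ipx M (vmoment m G) phi.
Proof.
move=> pU; have [K HK] := Uh_bounded pU; have mp := Uh_measurable pU.
have FL := coord_linear_ipx_Uh pU.
have mD := measurableX mOx mOv.
have m1 : measurable_fun
    (Ox `*` Ov : set (measurableTypeR R * measurableTypeR R)%type)
    (fun z => phi z.1).
  apply: (@measurable_comp _ _ _ (measurableTypeR R * measurableTypeR R)%type
    (measurableTypeR R) R Ox phi (Ox `*` Ov) fst mOx _ mp
    (measurable_funTS measurable_fst)).
  by move=> _ [[x v] [/= h _] <-].
have m2 : measurable_fun
    (Ox `*` Ov : set (measurableTypeR R * measurableTypeR R)%type)
    (fun z => z.2 : measurableTypeR R) := measurable_funTS measurable_snd.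
have K2 (z : R * R) (zD : (Ox `*` Ov) z) : `|z.2| <= 1 := Omega_v_le1 zD.2.
(* Three weights are used: G phi for the slices at fixed v, G v for the measurability of the moment
   of G, and G phi v for the Fubini exchange. *)
have iGp := integrableM_bounded mD G1 m1 (fun z zD => HK z.1 zD.1).
have iGv := integrableM_bounded mD G1 m2 K2.
have iF := integrableM_bounded mD iGp m2 K2.
have fub := @fubini (fun x v => G x v * phi x * v) iF.
have aex := @ae_fst G G1.
have aev := @ae_snd (fun x v => G x v * phi x) iGp.
have mvG : measurable_fun (Ox : set (measurableTypeR R)) (vmoment m G).
  have := @int_fst (fun x v => G x v * v) iGv.
  move=> /measurable_int/measurable_EFinP; apply: eq_measurable_fun => x _.
  by apply: eq_Rintegral => v _; rewrite mulrC.
transitivity (\int[leb]_(x in Ox) \int[mu_v m]_(v in Ov) (G x v * phi x * v)).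
(* On the discrete side the average passes through the inner product as a finite sum, so Fubini is
   applied to G alone. The projection identity is then used for almost every v. *)
{ rewrite fub (coord_linear_vmoment FL gU).
  apply: ae_eq_Rintegral => //.
  - have := vintM_v (vint_coord_linear FL gU).
    by move=> /measurable_int/measurable_EFinP.
  - have := @int_snd (fun x v => G x v * phi x * v) iF.
    by move=> /measurable_int/measurable_EFinP.
  - have h := ae_ipx_pi pU.
    apply: (@filterS2 _ _ (ae_filter_ringOfSetsType (mu_v m)) _ _ _ _ h aev).
    move=> v f1 f2 Ovv; rewrite (f1 Ovv) mulrC /ipx -RintegralZr//.
    exact: f2. }
apply: ae_eq_Rintegral => //.
- have := @int_fst (fun x v => G x v * phi x * v) iF.
  by move=> /measurable_int/measurable_EFinP.
- exact: measurable_funM.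
- apply: (@filterS _ _ (ae_filter_ringOfSetsType leb) _ _ _ aex) => x f1 Oxx.
  rewrite /vmoment /avg -RintegralZr//; last exact: vintM_v (f1 Oxx).
  by apply: eq_Rintegral => v _; rewrite mulrC mulrA mulrAC.
Qed.

Lemma normxv_sqr : normxv M m G ^+ 2 = avg m (fun v => ipx M (G^~ v) (G^~ v)).
Proof.
rewrite /normxv sqr_sqrtr; last by apply: avg_ge0 => v _; rewrite sqr_ge0.
by apply: avg_eq => v _; rewrite /normx sqr_sqrtr// ipx_ge0.
Qed.

Let ipGE v : ipx M (G^~ v) (G^~ v) = \int[leb]_(x in Ox) (G x v ^+ 2).
Proof. by apply: eq_Rintegral => x _; rewrite expr2. Qed.

(** The nodal value of the projection is the inner product of G with phi, and |ab| <= a^2 + b^2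
    bounds it by squared norms. Averaging turns the L2 bound on the initial data into the L1-in-v
    bound that the induction carries. *)
Lemma avg_dual_initial phi (J : idx) : Uh phi ->
  (forall u, Uh u -> ipx M u phi = u (xpt J)) ->
  avg m (fun v => `|g (xpt J) v|) <=
  normxv M m G ^+ 2 + ipx M phi phi * avg m (fun=> 1).
Proof.
move=> pU pE; have [K HK] := Uh_bounded pU; have mp := Uh_measurable pU.
have [_ iG] := G2; have [_ ip] := Uh_L2x pU.
have iS : vint m (fun v => ipx M (G^~ v) (G^~ v)).
  apply: vint_eq (@int_snd (fun x v => G x v ^+ 2) iG).
  by move=> v _; rewrite ipGE.
rewrite normxv_sqr -avg_cst -avgD//; last exact: vint_cst.
apply: ae_le_Rintegral => //.
- exact: vint_norm (gU.2 J).
- by apply: vintD => //; exact: vint_cst.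
- by move=> v _; rewrite addr_ge0// ipx_ge0.
- have h := ae_ipx_pi pU.
  apply: (@filterS2 _ _ (ae_filter_ringOfSetsType (mu_v m)) _ _ _ _ h aeG2).
  move=> v f1 f2 Ovv; rewrite -(pE _ (gU.1 v Ovv)) (f1 Ovv).
  have iGp := integrableM_bounded mOx (L2x_integrable (f2 Ovv)) mp HK.
  apply: le_trans (le_normr_Rintegral mOx iGp) _.
  have [_ iv] := f2 Ovv.
  rewrite {1}/ipx -RintegralD//.
  apply: le_Rintegral => //.
  + exact: integrable_norm iGp.
  + by have := integrableD mOx iv ip; exact: eq_integrable.
  + move=> x _ /=; rewrite ler_norml.
    have := sqr_ge0 (G x v); have := sqr_ge0 (phi x).
    have := sqr_ge0 (G x v - phi x); have := sqr_ge0 (G x v + phi x).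
    by move=> *; apply/andP; split; nra.
Qed.

End InitialData.

(** * The limit of vanishing epsilon *)

Section Limits.
Variables (R : realType) (M : mesh R) (k : nat) (m : velocity_model).

Notation N := (nelt M).
Notation idx := ('I_N * 'I_k.+1)%type.
Notation xpt := (@xpt R M k).
Notation Uh := (in_Uh M k).
Notation Ov := (Omega_v R m).

Lemma cvg_big_sum (T : Type) (F : set_system T) (FF : Filter F) (I : finType)
    (f : I -> T -> R) (l : I -> R) : (forall i, f i x @[x --> F] --> l i) ->
  (\sum_i f i x) @[x --> F] --> \sum_i l i.
Proof.
move=> fl; elim: (index_enum I) => [|i s IH].
  rewrite big_nil; under eq_fun do rewrite big_nil; exact: cvg_cst.
rewrite big_cons; under eq_fun do rewrite big_cons.
exact: cvgD.
Qed.

Lemma coord_linear_cvg (T : Type) (F : set_system T) (FF : Filter F)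
    (L : (R -> R) -> R) (u : T -> R -> R) (l : idx -> R) :
  coord_linear M k L -> (\forall e \near F, Uh (u e)) ->
  (forall I, u e (xpt I) @[e --> F] --> l I) ->
  L (u e) @[e --> F] --> L (expand l).
Proof.
move=> [K HK] uU ul; rewrite (HK _ (expand_Uh l)).
apply: (@cvg_trans _ ((\sum_I u e (xpt I) * K I) @[e --> F])).
  by apply: near_eq_cvg; apply: filterS uU => e /HK ->.
apply: cvg_big_sum => I; rewrite expand_xpt; apply: cvgM => //; exact: cvg_cst.
Qed.

Lemma near_right_itv (e0 : R) : 0 < e0 -> \forall e \near 0^'+, 0 < e <= e0.
Proof.
move=> e00; near=> e; apply/andP; split; near: e; first exact: nbhs_right_gt.
exact: nbhs_right_ltW.
Unshelve. all: by end_near. Qed.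

Lemma cvg_near_right_id (K : R) : (e * K) @[e --> 0^'+] --> (0 : R).
Proof.
rewrite -[X in _ --> X](mul0r K); apply: cvgM; last exact: cvg_cst.
by apply: cvg_at_right_filter; exact: cvg_id.
Qed.

Section Scheme.
Variables (fl : flux_pair) (dt C e0 : R).
Hypotheses (dt_gt0 : 0 < dt) (e0_gt0 : 0 < e0).
Hypothesis C_inv : trace_inverse_const k C.
Variables (rho : R -> nat -> R -> R) (g : R -> nat -> R -> R -> R).
Hypothesis scheme : forall e, 0 < e <= e0 ->
  DG_IMEX1 M k m fl dt e (rho e) (g e).

Let good : \forall e \near 0^'+, 0 < e <= e0 := near_right_itv e0_gt0.
Let good1 : \forall e \near 0^'+, 0 < e <= 1 := near_right_itv ltr01.

Lemma rho_Uh e n : 0 < e <= e0 -> Uh (rho e n).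
Proof. by move=> /scheme/(_ n)[]. Qed.

Lemma g_Uh e n : 0 < e <= e0 -> Uh_vint M k m (g e n).
Proof. by move=> /scheme/(_ n)[_ gU _ _]; exact: in_Uhv_vint. Qed.

Lemma q_Uh e n : 0 < e <= e0 -> Uh (vmoment m (g e n)).
Proof. by move=> /g_Uh/vmoment_Uh. Qed.

(** This is minus [a_h], read as a functional of the moment q alone. *)
Definition flux_form (phi q : R -> R) : R :=
  \sum_(i < N) \int[@lebesgue_measure R]_(x in cell i) (q x * derive1 phi x)
  + \sum_(i < N) flux_q fl q i * jump phi i.

Lemma ipx_dquot u w phi : Uh u -> Uh w -> Uh phi ->
  ipx M (fun x => (u x - w x) / dt) phi = (ipx M u phi - ipx M w phi) / dt.
Proof.
move=> uU wU /coord_linear_ipx_Uh FL.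
have -> : (fun x => (u x - w x) / dt) =
    (fun x => dt^-1 * u x + (- dt^-1) * w x).
  by apply/funext => x; rewrite mulNr -mulrBr mulrC.
rewrite (coord_linear_lin FL uU wU); last exact: Uh_lin.
by rewrite mulNr -mulrBr mulrC.
Qed.

Lemma macro_step e n phi : 0 < e <= e0 -> Uh phi ->
  ipx M (rho e n.+1) phi =
  ipx M (rho e n) phi + dt * flux_form phi (vmoment m (g e n)).
Proof.
move=> eg pU; have [_ _ /(_ phi pU) + _] := scheme eg n.
rewrite (ipx_dquot (rho_Uh _ eg) (rho_Uh _ eg) pU) /a_h -opprD.
move/eqP; rewrite subr_eq0 => /eqP h; rewrite /flux_form -h.
by rewrite mulrC divfK ?gt_eqF// addrC subrK.
Qed.

Definition converging n := [/\
  forall I : idx, cvg (rho e n (xpt I) @[e --> 0^'+]),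
  forall I : idx, cvg (vmoment m (g e n) (xpt I) @[e --> 0^'+]) &
  exists B, \forall e \near 0^'+, vmass M k m (g e n) <= B].

Definition rho_lim n (I : idx) := lim (rho e n (xpt I) @[e --> 0^'+]).
Definition q_lim n (I : idx) := lim (vmoment m (g e n) (xpt I) @[e --> 0^'+]).

Lemma rho_cvg L n : coord_linear M k L ->
  (forall I : idx, cvg (rho e n (xpt I) @[e --> 0^'+])) ->
  L (rho e n) @[e --> 0^'+] --> L (expand (rho_lim n)).
Proof.
move=> LL c; apply: coord_linear_cvg => //.
by apply: filterS good => e /rho_Uh.
Qed.

Lemma q_cvg L n : coord_linear M k L ->
  (forall I : idx, cvg (vmoment m (g e n) (xpt I) @[e --> 0^'+])) ->
  L (vmoment m (g e n)) @[e --> 0^'+] --> L (expand (q_lim n)).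
Proof.
move=> LL c; apply: coord_linear_cvg => //.
by apply: filterS good => e /q_Uh.
Qed.

(** The macroscopic update is explicit in q^n, so the limit of rho^{n+1} needs data of step n only.
    It has to precede the microscopic limit, where [d_h] is taken at rho^{n+1}. *)
Lemma rho_cvgS n : converging n ->
  forall I : idx, cvg (rho e n.+1 (xpt I) @[e --> 0^'+]).
Proof.
move=> [cr cq _] J; have [beta [bU bE]] := dual_basis M C_inv.
have FL := coord_linear_ipx_Uh (bU J).
have QL := coord_linear_a_q fl (bU J).
apply: (cvgP (ipx M (expand (rho_lim n)) (beta J)
  + dt * flux_form (beta J) (expand (q_lim n)))).
apply: (@cvg_trans _ ((ipx M (rho e n) (beta J)
    + dt * flux_form (beta J) (vmoment m (g e n))) @[e --> 0^'+])).
  apply: near_eq_cvg; apply: filterS good => e eg.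
  by rewrite -(macro_step _ eg (bU J)) bE//; exact: rho_Uh.
apply: cvgD; first exact: rho_cvg FL cr.
by apply: cvgM; [exact: cvg_cst|exact: q_cvg QL cq].
Qed.

Let eqn e n psi : 0 < e <= e0 -> Uh psi -> forall v, Ov v ->
     ipx M (fun x => (g e n.+1 x v - g e n x v) / dt) psi
     + 1 / e * b_hv M k m v (g e n) psi
     - v / e ^+ 2 * d_h M fl (rho e n.+1) psi
     = - (1 / e ^+ 2) * ipx M (g e n.+1 ^~ v) psi.
Proof. by move=> /scheme/(_ n)[_ _ _]; apply. Qed.

Lemma micro_limit n psi : converging n -> Uh psi ->
  avg m (fun v => `|ipx M (g e n.+1 ^~ v) psi - v * d_h M fl (rho e n.+1) psi|)
    @[e --> 0^'+] --> (0 : R).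
Proof.
move=> cn pU; have [_ _ [B HB]] := cn.
have [K K0 HK] := micro_estimate m C_inv fl dt_gt0 pU.
have dcvg := rho_cvg (coord_linear_d_h fl pU) (rho_cvgS cn).
set d := d_h M fl (expand _) psi in dcvg.
have dB : \forall e \near 0^'+, `|d_h M fl (rho e n.+1) psi| <= `|d| + 1.
  by apply: cvgr_norm_le dcvg _ _; rewrite ltrDl.
apply: (@squeeze_cvgr _ _ _ _ (cst 0) (fun e => e * (K * (B + (`|d| + 1))))).
- near=> e.
  have eg : 0 < e <= e0 by near: e; exact: good.
  have eg1 : 0 < e <= 1 by near: e; exact: good1.
  apply/andP; split; first by apply: avg_ge0.
  apply: (le_trans (HK _ _ _ _ eg1 (g_Uh n eg) (g_Uh n.+1 eg) (eqn n eg pU))).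
  apply: ler_wpM2l; first by case/andP: eg => /ltW.
  apply: ler_wpM2l => //; apply: lerD; first by near: e; exact: HB.
  by near: e; exact: dB.
- exact: cvg_cst.
- exact: cvg_near_right_id.
Unshelve. all: by end_near. Qed.

Lemma moment_limit n psi : converging n -> Uh psi ->
  ipx M (vmoment m (g e n.+1)) psi @[e --> 0^'+] -->
  avg m (fun v => v ^+ 2) * d_h M fl (expand (rho_lim n.+1)) psi.
Proof.
move=> cn pU; have ml := micro_limit cn pU.
have FL := coord_linear_ipx_Uh pU.
have dcvg := rho_cvg (coord_linear_d_h fl pU) (rho_cvgS cn).
pose r e := ipx M (vmoment m (g e n.+1)) psi
  - avg m (fun v => v ^+ 2) * d_h M fl (rho e n.+1) psi.
(* The remainder is the average of v times the microscopic residual; since |v| <= 1, it is dominated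
   by the quantity of [micro_limit]. *)
have r0 : r e @[e --> 0^'+] --> (0 : R).
  apply/norm_cvg0P; apply: (@squeeze_cvgr _ _ _ _ (cst 0) _ _ _ _ _ ml).
    near=> e; have eg : 0 < e <= e0 by near: e; exact: good.
    rewrite normr_ge0 /= /r.
    have gU := g_Uh n.+1 eg.
    set d := d_h _ _ _ _.
    have vi : vint m (fun v => ipx M (g e n.+1 ^~ v) psi - v * d).
      apply: vintB; first exact: (vint_coord_linear FL gU).
      by apply: vintM_v; exact: vint_cst.
    have v2 : vint m (fun v : R => v ^+ 2).
      apply: vint_eq (vintM_v (vintM_v (vint_cst m 1))) => v _.
      by rewrite mulr1 expr2.
    have -> : ipx M (vmoment m (g e n.+1)) psi - avg m (fun v => v ^+ 2) * d =
        avg m (fun v => v * (ipx M (g e n.+1 ^~ v) psi - v * d)).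
      rewrite (coord_linear_vmoment FL gU) mulrC -avgZ//.
      rewrite -avgB; [|exact: vintM_v (vint_coord_linear FL gU)|exact: vintZ].
      by apply: avg_eq => v _; ring.
    apply: le_trans (norm_avg (vintM_v vi)) _.
    apply: le_avg; [exact: vint_norm (vintM_v vi)|exact: vint_norm|].
    by move=> v /Omega_v_le1 v1; rewrite normrM ler_piMl.
  exact: cvg_cst.
have lim1 : (r e + avg m (fun v => v ^+ 2) * d_h M fl (rho e n.+1) psi)
    @[e --> 0^'+] -->
    0 + avg m (fun v => v ^+ 2) * d_h M fl (expand (rho_lim n.+1)) psi.
  by apply: cvgD r0 _; apply: cvgM dcvg; exact: cvg_cst.
rewrite add0r in lim1; apply: cvg_trans lim1; apply: near_eq_cvg; near=> e.
by rewrite /r /= subrK.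
Unshelve. all: by end_near. Qed.

(** At each node, |g| <= |g - v d| + |d| for |v| <= 1. The averaged residual tends to 0 and d
    converges, so the sum eventually stays below its limit plus 1. *)
Lemma vmass_step n : converging n ->
  exists B, \forall e \near 0^'+, vmass M k m (g e n.+1) <= B.
Proof.
move=> cn; have [beta [bU bE]] := dual_basis M C_inv.
pose mu1 := avg m (fun=> 1 : R).
pose d e J := d_h M fl (rho e n.+1) (beta J).
pose r e J := avg m (fun v => `|ipx M (g e n.+1 ^~ v) (beta J) - v * d e J|).
have lim1 : (\sum_J (r e J + `|d e J| * mu1)) @[e --> 0^'+] -->
    \sum_J (0 + `|d_h M fl (expand (rho_lim n.+1)) (beta J)| * mu1).
  apply: cvg_big_sum => J; apply: cvgD; first exact: micro_limit.
  apply: cvgM; last exact: cvg_cst.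
  apply: cvg_norm; exact: (rho_cvg (coord_linear_d_h fl (bU J)) (rho_cvgS cn)).
set l := \sum_J _ in lim1; exists (l + 1).
have lb : \forall e \near 0^'+, \sum_J (r e J + `|d e J| * mu1) <= l + 1.
  by apply: cvgr_le lim1 _ _; rewrite ltrDl.
near=> e; have eg : 0 < e <= e0 by near: e; exact: good.
have gU := g_Uh n.+1 eg.
apply: (@le_trans _ _ (\sum_J (r e J + `|d e J| * mu1))); last by near: e.
apply: ler_sum => J _.
have FL := coord_linear_ipx_Uh (bU J).
have vi : vint m (fun v => ipx M (g e n.+1 ^~ v) (beta J) - v * d e J).
  apply: vintB; first exact: (vint_coord_linear FL gU).
  by apply: vintM_v; exact: vint_cst.
rewrite /mu1 -avg_cst /r -avgD; [|exact: vint_norm|exact: vint_cst].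
apply: le_avg; first exact: vint_norm (gU.2 J).
  by apply: vintD; [exact: vint_norm|exact: vint_cst].
move=> v Ovv; rewrite -(bE J _ (gU.1 v Ovv)).
rewrite -[X in `|X|](subrK (v * d e J)); apply: le_trans (ler_normD _ _) _.
by rewrite lerD2l normrM ler_piMl// (Omega_v_le1 Ovv).
Unshelve. all: by end_near. Qed.

Lemma converging_step n : converging n -> converging n.+1.
Proof.
move=> cn; split; [exact: rho_cvgS| |exact: vmass_step].
move=> J; have [beta [bU bE]] := dual_basis M C_inv.
apply: cvgP; apply: cvg_trans (moment_limit cn (bU J)).
apply: near_eq_cvg; apply: filterS good => e eg; rewrite bE//; exact: q_Uh.
Qed.

Hypothesis conv0 : converging 0.

Lemma converging_all n : converging n.
Proof. by elim: n => // n; exact: converging_step. Qed.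

Lemma macro_limit_eq n phi : Uh phi ->
  ipx M (fun x => (expand (rho_lim n.+1) x - expand (rho_lim n) x) / dt) phi
  = flux_form phi (expand (q_lim n)).
Proof.
move=> pU; have [cr cq _] := converging_all n.
have [cr' _ _] := converging_all n.+1.
have FL := coord_linear_ipx_Uh pU.
have QL := coord_linear_a_q fl pU.
rewrite ipx_dquot//; try exact: expand_Uh.
have h1 := rho_cvg FL cr'.
have h2 : (ipx M (rho e n) phi + dt * flux_form phi (vmoment m (g e n)))
      @[e --> 0^'+] -->
    ipx M (expand (rho_lim n)) phi + dt * flux_form phi (expand (q_lim n)).
  apply: cvgD; first exact: rho_cvg FL cr.
  by apply: cvgM; [exact: cvg_cst|exact: q_cvg QL cq].
have h3 : ipx M (rho e n.+1) phi @[e --> 0^'+] -->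
    ipx M (expand (rho_lim n)) phi + dt * flux_form phi (expand (q_lim n)).
  apply: cvg_trans h2; apply: near_eq_cvg; apply: filterS good => e eg.
  by rewrite (macro_step _ eg pU).
have -> : ipx M (expand (rho_lim n.+1)) phi =
    ipx M (expand (rho_lim n)) phi + dt * flux_form phi (expand (q_lim n)).
  exact: (cvg_unique _ h1 h3).
by rewrite addrC addrA addNr add0r mulrC mulKf// gt_eqF.
Qed.

Lemma moment_limit_eq n psi : Uh psi ->
  ipx M (expand (q_lim n.+1)) psi =
  avg m (fun v => v ^+ 2) * d_h M fl (expand (rho_lim n.+1)) psi.
Proof.
move=> pU; have [_ cq _] := converging_all n.+1.
have FL := coord_linear_ipx_Uh pU.
exact: (cvg_unique _ (q_cvg FL cq) (moment_limit (converging_all n) pU)).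
Qed.

Lemma rho_strong_cvg n :
  strong_cvg M (fun e => rho e n) (expand (rho_lim n)).
Proof.
have [cr _ _] := converging_all n.
have lU := @expand_Uh R M k (rho_lim n).
rewrite /strong_cvg -[X in _ --> X](@sqrtr0 R).
apply: continuous_cvg; first exact: sqrt_continuous.
pose w e x := rho e n x - expand (rho_lim n) x.
have wU e : 0 < e <= e0 -> Uh (w e).
  move=> /(rho_Uh n) rU; have := Uh_lin 1 (-1) rU lU.
  by congr in_Uh; apply/funext => x; rewrite mul1r mulN1r.
have w0 I : w e (xpt I) @[e --> 0^'+] --> (0 : R).
  rewrite -[X in _ --> X](subrr (rho_lim n I)) /w; apply: cvgB; first exact: cr.
  by rewrite expand_xpt; exact: cvg_cst.
(* The squared norm of the error is the quadratic form of the Gram matrix of [bas] in its nodal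
   values, which all tend to 0. *)
have lim0 : (\sum_I \sum_J w e (xpt I) *
    (w e (xpt J) * ipx M (@bas R M k J) (@bas R M k I))) @[e --> 0^'+] -->
    \sum_(I : idx) \sum_(J : idx) 0 * (0 * ipx M (@bas R M k J) (@bas R M k I)).
  apply: cvg_big_sum => I; apply: cvg_big_sum => J.
  by apply: cvgM => //; apply: cvgM => //; exact: cvg_cst.
rewrite [X in _ --> X]big1 in lim0; last first.
  by move=> I _; apply: big1 => J _; rewrite mul0r.
apply: cvg_trans lim0.
apply: near_eq_cvg; apply: filterS good => e /wU eU.
rewrite (ipx_bas eU eU); apply: eq_bigr => I _.
rewrite -mulr_sumr; congr (_ * _).
by rewrite ipxC (ipx_bas eU); last exact: bas_Uh.
Qed.

Lemma q_weak_cvg n :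
  weak_cvg M (fun e => vmoment m (g e n)) (expand (q_lim n)).
Proof.
have [_ cq _] := converging_all n.
by move=> phi p2; exact: (q_cvg (coord_linear_ipx k p2) cq).
Qed.

End Scheme.
End Limits.

Theorem theorem3p10 (R : realType) (m : velocity_model) (fl : flux_pair)
  (M : mesh R) (k : nat) (dt c0 C Chat e0 : R)
  (dt_gt0 : 0 < dt) (c0_gt0 : 0 < c0) (c0_lt1 : c0 < 1) (e0_gt0 : 0 < e0)
  (C_gt0 : 0 < C) (C_inv : trace_inverse_const k C)
  (Chat_gt0 : 0 < Chat) (Chat_inv : inverse_const k Chat)
  (* initial data at t = 0, indexed by epsilon, and their limits *)
  (rho_in : R -> R -> R) (g_in : R -> R -> R -> R)
  (rho0 : R -> R) (g0 : R -> R -> R)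
  (rho_in_L2 : forall e, 0 < e <= e0 -> L2x M (rho_in e))
  (g_in_L2 : forall e, 0 < e <= e0 -> L2xv M m (g_in e))
  (rho0_L2 : L2x M rho0) (g0_L2 : L2xv M m g0)
  (g_in_avg : forall e, 0 < e <= e0 ->
    {ae @lebesgue_measure R, forall x, Omega_x M x -> avg m (g_in e x) = 0})
  (A1_rho : weak_cvg M rho_in rho0)
  (A1_q : weak_cvg M (fun e => vmoment m (g_in e)) (vmoment m g0))
  (A2_rho : has_ubound [set normx M (rho_in e) | e in `]0, e0]])
  (A2_g : has_ubound [set normxv M m (g_in e) | e in `]0, e0]])
  (* DG-IMEX1 solutions, indexed by epsilon and n *)
  (rho : R -> nat -> R -> R) (g : R -> nat -> R -> R -> R)
  (scheme : forall e, 0 < e <= e0 -> DG_IMEX1 M k m fl dt e (rho e) (g e))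
  (rho_init : forall e, 0 < e <= e0 -> is_pi_h M k (rho_in e) (rho e 0%N))
  (g_init : forall e, 0 < e <= e0 ->
    {ae mu_v m, forall v, Omega_v R m v ->
       is_pi_h M k (g_in e ^~ v) (g e 0%N ^~ v)})
  (dt_lt : forall e, 0 < e <= e0 -> dt < dt_stab M m C Chat c0 e) :
  exists (rhol ql : nat -> R -> R),
    [/\ is_pi_h M k rho0 (rhol 0%N),
        is_pi_h M k (vmoment m g0) (ql 0%N),
        forall n, (0 < n)%N ->
          [/\ in_Uh M k (rhol n),
              in_Uh M k (ql n),
              strong_cvg M (fun e => rho e n) (rhol n)
            & weak_cvg M (fun e => vmoment m (g e n)) (ql n)]
      & forall n,
          (forall phi, in_Uh M k phi ->
             ipx M (fun x => (rhol n.+1 x - rhol n x) / dt) phi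
             - \sum_(i < nelt M)
                 \int[@lebesgue_measure R]_(x in cell i) (ql n x * derive1 phi x)
             - \sum_(i < nelt M) flux_q fl (ql n) i * jump phi i = 0)
          /\
          (forall psi, in_Uh M k psi ->
             ipx M (ql n.+1) psi =
             avg m (fun v => v ^+ 2) *
             (\sum_(i < nelt M)
                \int[@lebesgue_measure R]_(x in cell i)
                  (rhol n.+1 x * derive1 psi x)
              + \sum_(i < nelt M) flux_rho fl (rhol n.+1) i * jump psi i))].

Proof.
have in0 := near_right_itv e0_gt0.
have gU e (eg : 0 < e <= e0) := g_Uh scheme 0 eg.
have [beta [bU bE]] := dual_basis M C_inv.
(* Against test functions of U_h, the projected and the original data have the same inner products,
   so the weak limits apply directly. *)
have rho_init_cvg phi : in_Uh M k phi ->
    ipx M (rho e 0%N) phi @[e --> 0^'+] --> ipx M rho0 phi.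
  move=> pU; have h := A1_rho _ (Uh_L2x pU); apply: cvg_trans h.
  apply: near_eq_cvg; apply: filterS in0 => e eg.
  by have [_ ->] := rho_init e eg.
have q_init_cvg phi : in_Uh M k phi ->
    ipx M (vmoment m (g e 0%N)) phi @[e --> 0^'+] --> ipx M (vmoment m g0) phi.
  move=> pU; have h := A1_q _ (Uh_L2x pU); apply: cvg_trans h.
  apply: near_eq_cvg; apply: filterS in0 => e eg.
  by rewrite (ipx_vmoment_initial (g_in_L2 e eg) (gU e eg) (g_init e eg) pU).
have conv0 : converging M k m rho g 0.
  split.
  - move=> J; apply: cvgP; apply: cvg_trans (rho_init_cvg _ (bU J)).
    apply: near_eq_cvg; apply: filterS in0 => e eg.
    by rewrite bE//; exact: (rho_Uh scheme 0 eg).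
  - move=> J; apply: cvgP; apply: cvg_trans (q_init_cvg _ (bU J)).
    apply: near_eq_cvg; apply: filterS in0 => e eg.
    by rewrite bE//; exact: (q_Uh scheme 0 eg).
  - have [B HB] := A2_g.
    exists (\sum_J (B ^+ 2 + ipx M (beta J) (beta J) * avg m (fun=> 1))).
    apply: filterS in0 => e eg; apply: ler_sum => J _.
    apply: le_trans (avg_dual_initial (g_in_L2 e eg) (gU e eg) (g_init e eg)
      (bU J) (bE J)) _.
    have gB : normxv M m (g_in e) <= B.
      by apply: HB; exists e => //=; rewrite in_itv.
    have g0' : 0 <= normxv M m (g_in e) by exact: sqrtr_ge0.
    by rewrite lerD2r lerXn2r// nnegrE (le_trans g0').
exists (fun n => expand (@rho_lim R M k rho n)).
exists (fun n => expand (@q_lim R M k m g n)).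
split.
(* The limit at n = 0 is recognised as the projection by uniqueness of limits: the same pairings
   with phi tend both to that of the nodal limit and to that of [rho0]. *)
- split=> [|phi pU]; first exact: expand_Uh.
  have FL := coord_linear_ipx_Uh pU.
  have [cr _ _] := conv0.
  exact: (cvg_unique _ (rho_cvg e0_gt0 scheme FL cr) (rho_init_cvg _ pU)).
- split=> [|phi pU]; first exact: expand_Uh.
  have FL := coord_linear_ipx_Uh pU.
  have [_ cq _] := conv0.
  exact: (cvg_unique _ (q_cvg e0_gt0 scheme FL cq) (q_init_cvg _ pU)).
- move=> n _; split; [exact: expand_Uh|exact: expand_Uh| |].
  + exact: (rho_strong_cvg dt_gt0 e0_gt0 C_inv scheme conv0).
  + exact: (q_weak_cvg dt_gt0 e0_gt0 C_inv scheme conv0).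
- move=> n; split=> [phi pU|psi pU].
  + rewrite (macro_limit_eq dt_gt0 e0_gt0 C_inv scheme conv0 n pU).
    by rewrite /flux_form -addrA -opprD subrr.
  + exact: (moment_limit_eq dt_gt0 e0_gt0 C_inv scheme conv0 n pU).
Qed.
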